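(* Let $Z=X+iY$ be a $\mathbb{C}$-valued continuous conformal martingale starting at zero on a filtered probability space satisfying the usual conditions. Then \[ \|Y\|_p\le\cot\Big(\frac{\pi}{2p}\Big)\|X\|_p\quad\text{for } p=2^k,\ k\in\mathbb{N}. \]
   Context: A $\mathbb{C}$-valued continuous ($L^p$-bounded) martingale $Z=X+iY$ is conformal if $\langle X\rangle_t=\langle Y\rangle_t$ and $\langle X,Y\rangle_t=0$ for all $t\ge0$. For a martingale $X$, $\|X\|_p=\sup_{t>0}\|X_t\|_{L^p(\mathbb{P})}$. *)

(* Defs.v *)
From HB Require Import structures.
From mathcomp Require Import all_boot all_order all_algebra.
From mathcomp Require Import all_classical all_reals all_analysis.
Set Implicit Arguments. Unset Strict Implicit. Unset Printing Implicit Defensive.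
Import Order.TTheory GRing.Theory Num.Theory.
Import numFieldNormedType.Exports.
Local Open Scope classical_set_scope.
Local Open Scope ring_scope.

(* Continuous-time processes indexed by t : R (only t >= 0 matters),
   filtrations F : R -> set (set T) (F t = the sigma-algebra F_t). *)
Section Defs.
Context {d : measure_display} {T : measurableType d} {R : realType}.
Variable P : probability T R.

Definition usual_filtration (F : R -> set (set T)) : Prop :=
  (forall t, 0 <= t -> sigma_algebra setT (F t)) /\
  (forall t, 0 <= t -> F t `<=` measurable) /\
  (forall s t, 0 <= s -> s <= t -> F s `<=` F t) /\
  (forall t, 0 <= t -> F t = \bigcap_(u in `]t, +oo[) F u) /\
  (forall N : set T, P.-negligible N -> F 0 N).

Definition adapted (F : R -> set (set T)) (X : R -> T -> R) : Prop :=
  forall t, 0 <= t -> forall B : set R, measurable B -> F t (X t @^-1` B).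

(* real-valued martingale w.r.t. F (conditional expectation expressed
   through its defining property) *)
Definition martingale (F : R -> set (set T)) (X : R -> T -> R) : Prop :=
  adapted F X /\
  (forall t, 0 <= t -> P.-integrable setT (fun w => (X t w)%:E)) /\
  (forall s t, 0 <= s -> s <= t -> forall A, F s A ->
     (\int[P]_(w in A) (X t w)%:E = \int[P]_(w in A) (X s w)%:E)%E).

Definition cont_paths (X : R -> T -> R) : Prop :=
  forall w, {within `[0, +oo[, continuous (fun t => X t w)}.

Definition is_qcov (F : R -> set (set T)) (X Y A : R -> T -> R) : Prop :=
  adapted F A /\ cont_paths A /\ (forall w, A 0 w = 0) /\
  (forall w t, 0 <= t -> bounded_variation 0 t (fun s => A s w)) /\
  martingale F (fun t w => X t w * Y t w - A t w).

Definition is_qvar (F : R -> set (set T)) (X A : R -> T -> R) : Prop :=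
  is_qcov F X X A /\
  (forall w s t, 0 <= s -> s <= t -> A s w <= A t w).

Definition conformal (F : R -> set (set T)) (X Y : R -> T -> R) : Prop :=
  exists A, is_qvar F X A /\ is_qvar F Y A /\ is_qcov F X Y (fun _ _ => 0).

Definition mnorm (p : R) (X : R -> T -> R) : \bar R :=
  ereal_sup [set Lnorm P p%:E (fun w => (X t w)%:E) | t in `]0, +oo[].

Definition Lp_bounded (p : R) (X : R -> T -> R) : Prop :=
  (mnorm p X < +oo)%E.

End Defs.

Definition cot {R : realType} (x : R) : R := cos x / sin x.

(* Main.v *)
Require Import Defs.
From HB Require Import structures.
From mathcomp Require Import all_boot all_order all_algebra.
From mathcomp Require Import all_classical all_reals all_analysis.
From mathcomp Require Import measurable_realfun complex ring lra.
Import Order.TTheory GRing.Theory Num.Theory.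
Import numFieldNormedType.Exports.
Local Open Scope classical_set_scope.
Local Open Scope ring_scope.

                                        

                                                                                
                                                                               
                                                                              
                                                                           
                                                                 

                                                                             
                                                                               
                                                                                
                                                                                
                                                                                 
                                                                                
                                                                                
                       

                                 

(** Write [p] for [2 ^ k] and [Z = X + iY]. The proof combines a pointwise inequality on the plane
    with the fact that [Z ^ p] has mean zero.

    The pointwise inequality ([pointwise_ineq]) is [y^p <= cot(pi/2p)^p x^p + b Re (x+iy)^p] for
    some real constant [b], and likewise with [x] and [y] exchanged. It is proved by doubling the
    exponent: since [Re z^(2p) = Re (z^2)^p], the exchanged inequality at [z^2 = (x^2 - y^2) + 2ixy]
    controls [|x^2 - y^2|^p] by [|2xy|^p]. Convexity, with weights supplied by the half-angle
    formula for the cotangent, then turns this into the inequality for [2p] ([doubling_step]).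
    Taking expectations at time [t] and using [E Re Z_t^p = 0], one gets
    [E Y_t^p <= cot(pi/2p)^p E X_t^p]; a [p]-th root and a supremum over [t] finish the proof.

    That [E Re Z_t^p = 0] ([mean_zpow0]) is shown without stochastic calculus. Conformality makes
    [X^2 - Y^2] and [XY] martingales, that is, [Z^2] is one as well as [Z]. Along a grid of
    [[0, t]], expand [z'^p - z^p] to second order in [w = z' - z] and substitute
    [w^2 = (z'^2 - z^2) - 2zw]: everything but the remainder is a function of the past times a
    martingale increment ([zpow_expansion]). Before the path leaves a box of size [M] or makes a
    grid step larger than [D], these terms have mean zero and the cubic remainder is at most
    [K D |w|^2], whose expectations telescope to at most [K D E |Z_t|^2] ([step_bound],
    [stopped_bound]). On the exceptional paths everything is dominated by the terminal variable
    [X_t^p + Y_t^p], because even powers of martingales are submartingales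
    ([submartingale_even_pow]). Continuity of paths makes the exceptional events vanish, and
    dominated convergence ([mean_vanishing]) makes their contribution as small as desired. *)

(** * The pointwise inequality on the plane *)

Section Pointwise.
Local Open Scope complex_scope.
Context {R : realType}.
Implicit Types x y a b c : R.

(** Convexity of an even power at [a + b = l (a / l) + m (b / m)]. For squares the defect is a
    perfect square; the induction hypothesis is then used at [a ^+ 2 / l] and [b ^+ 2 / m]. *)
Lemma weighted_convexity k (l m a b : R) : 0 < l -> 0 < m -> l + m = 1 ->
  0 <= a -> 0 <= b ->
  (a + b) ^+ (2 ^ k) <=
    l * (a / l) ^+ (2 ^ k) + m * (b / m) ^+ (2 ^ k).
Proof.
move=> l0 m0 lm; elim: k a b => [|k IH] a b a0 b0.
  by rewrite expn0 !expr1 mulrCA divff ?gt_eqF// mulr1 mulrCA divff ?gt_eqF// mulr1.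
rewrite expnS !exprM.
have h : (a + b) ^+ 2 <= a ^+ 2 / l + b ^+ 2 / m.
  rewrite -subr_ge0.
  have -> : a ^+ 2 / l + b ^+ 2 / m - (a + b) ^+ 2 = (a * m - b * l) ^+ 2 / (l * m).
    have -> : m = 1 - l by lra.
    by field; rewrite ?gt_eqF//; lra.
  by rewrite divr_ge0// ?sqr_ge0// mulr_ge0// ltW.
apply: le_trans (_ : (a ^+ 2 / l + b ^+ 2 / m) ^+ (2 ^ k) <= _).
  by rewrite lerXn2r// ?nnegrE ?sqr_ge0// addr_ge0// divr_ge0// ?sqr_ge0// ltW.
have -> : (a / l) ^+ 2 = a ^+ 2 / l / l by field; rewrite gt_eqF.
have -> : (b / m) ^+ 2 = b ^+ 2 / m / m by field; rewrite gt_eqF.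
by apply: IH; rewrite divr_ge0// ?sqr_ge0// ltW.
Qed.

Lemma cot_gt0 (t : R) : 0 < t -> t < pi / 2 -> 0 < cot t.
Proof.
move=> t0 t1; rewrite /cot divr_gt0//.
  by apply: cos_gt0_pihalf; rewrite t1 andbT; apply: lt_trans t0; rewrite oppr_lt0 divr_gt0 ?pi_gt0.
by rewrite sin_gt0_pi// t0/=; apply: lt_trans t1 _; have := pi_gt0 R; lra.
Qed.

Lemma cot_half (t : R) : 0 < t -> t < pi / 2 ->
  cot (t / 2) ^+ 2 = 1 + 2 * cot t * cot (t / 2).
Proof.
move=> t0 t1.
have s0 : 0 < sin (t / 2) by rewrite sin_gt0_pi//; have := pi_gt0 R; lra.
have c0 : 0 < cos (t / 2).
  by apply: cos_gt0_pihalf; have := pi_gt0 R; lra.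
have et : t = t / 2 + t / 2 by lra.
rewrite /cot [in cos t]et [in sin t]et cosD sinD.
by field; rewrite ?gt_eqF ?addr_gt0 ?mulr_gt0.
Qed.

                                                                                 
                                                               
(** The passage from exponent [q = 2 ^ k] to [2q], with [c] and [C] the cotangents at an angle and
    at its half, [d = |x^2 - y^2|], and [e] a multiple of the harmonic polynomial. Convexity applied
    to [x ^+ 2 + d] yields a mixed term [|x|^q |y|^q], which is split by the arithmetic-geometric
    mean inequality and partly absorbed on the left. *)
Lemma doubling_step k (c C x y e d : R) : 0 < c -> 0 < C -> C ^+ 2 = 1 + 2 * c * C ->
  y ^+ 2 <= x ^+ 2 + d -> 0 <= d ->
  d ^+ (2 ^ k) <= c ^+ (2 ^ k) * (2 * `|x| * `|y|) ^+ (2 ^ k) + e ->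
  y ^+ (2 ^ k.+1) <= C ^+ (2 ^ k.+1) * x ^+ (2 ^ k.+1) +
    2 * c / C * (C / (2 * c)) ^+ (2 ^ k) / (1 - c / C) * e.
Proof.
move=> c0 C0 CE ydx d0 de.
rewrite expnS !exprM.
set q := (2 ^ k)%N in de *.
(* The half-angle relation says exactly that [1 / C^2] and [2c / C] are convex weights; it also
   gives [c / C < 1 / 2], so the division by [1 - c / C] is legitimate. *)
have lE : (C ^+ 2)^-1 = 1 - 2 * c / C.
  have -> : c = (C ^+ 2 - 1) / (2 * C) by rewrite CE; field; rewrite gt_eqF.
  by field; rewrite gt_eqF.
have l0 : 0 < (C ^+ 2)^-1 by rewrite invr_gt0 exprn_gt0.
have m0 : 0 < 2 * c / C by rewrite divr_gt0// mulr_gt0.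
have lm : (C ^+ 2)^-1 + 2 * c / C = 1 by rewrite lE; lra.
have cC : 0 < 1 - c / C by move: lE l0 m0; rewrite -!mulrA; lra.
have h1 := @weighted_convexity k _ _ (x ^+ 2) d l0 m0 lm (sqr_ge0 x) d0.
have h2 : (y ^+ 2) ^+ q <= (x ^+ 2 + d) ^+ q.
  by rewrite lerXn2r// ?nnegrE ?sqr_ge0// addr_ge0// sqr_ge0.
have := le_trans h2 h1; rewrite -/q.
have -> : x ^+ 2 / (C ^+ 2)^-1 = C ^+ 2 * x ^+ 2 by rewrite invrK mulrC.
have -> : d / (2 * c / C) = C / (2 * c) * d by field; rewrite ?gt_eqF.
rewrite [(C ^+ 2 * _) ^+ q]exprMn [(_ * d) ^+ q]exprMn => h3.
have h4 : (C / (2 * c)) ^+ q * d ^+ q <= C ^+ q * `|x| ^+ q * `|y| ^+ q + (C / (2 * c)) ^+ q * e.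
  apply: le_trans (ler_wpM2l _ de) _; first by rewrite exprn_ge0// divr_ge0// ltW// mulr_gt0.
  rewrite mulrDr lerD2r !exprMn exprVn exprMn.
  rewrite le_eqVlt; apply/orP; left; apply/eqP.
  by field; rewrite !expf_neq0// ?gt_eqF.
have sq2 (z : R) : (z ^+ 2) ^+ q = (`|z| ^+ q) ^+ 2.
  by rewrite -real_normK ?num_real// exprAC.
move: h3; rewrite !sq2 (gtr0_norm C0).
move: h4; move: (C ^+ q) (`|x| ^+ q) (`|y| ^+ q) ((C / (2 * c)) ^+ q) (d ^+ q) => Q s r G D h4 h3.
have {}h3 : r ^+ 2 <= (1 - 2 * (c / C)) * (Q ^+ 2 * s ^+ 2) + 2 * (c / C) * (Q * s * r + G * e).
  apply: le_trans h3 _; rewrite lE -(mulrA 2 c) lerD2l ler_wpM2l//.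
  by rewrite mulrA ltW.
rewrite -(mulrA 2 c); move: h3 cC m0; rewrite -(mulrA 2 c).
move: (c / C) => t h3 t1 t0.
(* With [t = c / C], replacing [2 Q s r] by [Q^2 s^2 + r^2] loses [t (Q s - r)^2], and [t r^2] moves
   to the left, leaving the factor [1 - t]. *)
rewrite -subr_ge0 -(pmulr_rge0 _ t1).
have -> : (1 - t) * (Q ^+ 2 * s ^+ 2 + 2 * t * G / (1 - t) * e - r ^+ 2) =
  ((1 - 2 * t) * (Q ^+ 2 * s ^+ 2) + 2 * t * (Q * s * r + G * e) - r ^+ 2) + t * (Q * s - r) ^+ 2.
  by field; rewrite gt_eqF.
by rewrite addr_ge0 ?subr_ge0// mulr_ge0 ?sqr_ge0//; lra.
Qed.

Definition zpow (n : nat) x y : R := complex.Re ((x +i* y) ^+ n).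



Lemma zpow2 x y : zpow 2 x y = x ^+ 2 - y ^+ 2.
Proof. by rewrite /zpow expr2 /= -!expr2. Qed.

Lemma zpow_double n x y : zpow n.*2 x y = zpow n (x ^+ 2 - y ^+ 2) (2 * x * y).
Proof.
rewrite /zpow -mul2n exprM; congr (complex.Re (_ ^+ _)).
by rewrite expr2; apply/eqP; rewrite eq_complex/=; apply/andP; split; apply/eqP; ring.
Qed.

(** Both inequalities are carried through the induction because the step for either one uses the
    second, bounding the real part of [z^2] by its imaginary part. *)
Lemma pointwise_ineq k : exists b g : R, forall x y,
  y ^+ (2 ^ k.+1) <= cot (pi / (2 * 2 ^+ k.+1)) ^+ (2 ^ k.+1) * x ^+ (2 ^ k.+1)
    + b * zpow (2 ^ k.+1) x y /\
  x ^+ (2 ^ k.+1) <= cot (pi / (2 * 2 ^+ k.+1)) ^+ (2 ^ k.+1) * y ^+ (2 ^ k.+1)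
    + g * zpow (2 ^ k.+1) x y.
Proof.
have pi0 := pi_gt0 R.
elim: k => [|k [b [g IH]]].
  (* For exponent two the constant is [cot (pi / 4) = 1] and both inequalities are equalities. *)
  exists (-1), 1 => x y; rewrite expn1 expr1 zpow2.
  have -> : cot (pi / (2 * 2)) = 1 :> R.
    have -> : pi / (2 * 2) = pi / 4%:R :> R by rewrite -natrM.
    by have := tan_piquarter R; rewrite /tan /cot -[X in _ -> X = _]invf_div => ->; rewrite invr1.
  by rewrite expr1n; split; lra.
set p := (2 ^ k.+1)%N in IH *.
set c : R := cot _ in IH; set C : R := cot _.
have t0 : 0 < pi / (2 * 2 ^+ k.+1) :> R by rewrite divr_gt0// mulr_gt0// exprn_gt0.
have t1 : pi / (2 * 2 ^+ k.+1) < pi / 2 :> R.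
  by rewrite ltr_pM2l// ltf_pV2 ?posrE ?mulr_gt0 ?exprn_gt0// ltr_pMr// exprn_egt1// ltr1n.
have c0 : 0 < c by exact: cot_gt0.
have th : pi / (2 * 2 ^+ k.+2) = pi / (2 * 2 ^+ k.+1) / 2 :> R.
  by rewrite -[RHS]mulrA -invfM (exprSr _ k.+1) mulrA.
have C0 : 0 < C by rewrite /C th cot_gt0//; lra.
have CE : C ^+ 2 = 1 + 2 * c * C by rewrite /C /c th cot_half.
pose K := 2 * c / C * (C / (2 * c)) ^+ p / (1 - c / C).
exists (K * g), (K * g) => x y.
have pe (z : R) : z ^+ p = `|z| ^+ p.
  by rewrite /p expnS !exprM real_normK ?num_real.
have zE : zpow (2 ^ k.+2) x y = zpow p (x ^+ 2 - y ^+ 2) (2 * x * y).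
  by rewrite expnS mul2n zpow_double.
(* The induction hypothesis at [z^2]. It is symmetric in [x] and [y] up to the sign of [x^2 - y^2],
   so it serves both conclusions. *)
have := (IH (x ^+ 2 - y ^+ 2) (2 * x * y)).2.
rewrite pe [X in _ <= _ * X + _ -> _]pe !normrM ger0_norm// -zE => h.
rewrite -(mulrA K); split.
- apply: (@doubling_step _ c C x y _ _ c0 C0 CE _ _ h); rewrite ?normr_ge0//.
  by rewrite -lerBlDl distrC ler_norm.
- rewrite mulrAC in h.
  apply: (@doubling_step _ c C y x _ _ c0 C0 CE _ _ h); rewrite ?normr_ge0//.
  by rewrite -lerBlDl ler_norm.
Qed.
End Pointwise.

                                          

(** * Second-order expansion of the real part of a complex power *)

Section Remainder.
Local Open Scope complex_scope.
Context {R : realType}.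
Implicit Types x y u v : R.

(** A submultiplicative norm on the complex numbers that stays in [R] and involves no square
    root. *)
Definition l1 (z : R[i]) : R := `|complex.Re z| + `|complex.Im z|.

Lemma l1_ge0 z : 0 <= l1 z. Proof. by rewrite addr_ge0. Qed.

Lemma l1D z w : l1 (z + w) <= l1 z + l1 w.
Proof. by case: z w => [a b] [c d]; rewrite /l1/= addrACA lerD ?ler_normD. Qed.

Lemma l1M z w : l1 (z * w) <= l1 z * l1 w.
Proof.
case: z w => [a b] [c d]; rewrite /l1/= mulrDl !mulrDr -!normrM.
apply: (le_trans (lerD (ler_normB _ _) (ler_normD _ _))).
by rewrite le_eqVlt; apply/orP; left; apply/eqP; ring.
Qed.

Lemma l1X z n : l1 (z ^+ n) <= l1 z ^+ n.
Proof.
elim: n => [|n IH]; first by rewrite !expr0 /l1/= normr0 normr1 addr0.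
by rewrite !exprS (le_trans (l1M _ _))// ler_wpM2l ?l1_ge0.
Qed.

Lemma l1Mn z n : l1 (z * n%:R) <= l1 z * n%:R.
Proof.
rewrite !mulr_natr; elim: n => [|n IH]; first by rewrite !mulr0n /l1/= normr0 addr0.
by rewrite !mulrS (le_trans (l1D _ _))// lerD.
Qed.

Lemma complex_natr m : m%:R = m%:R +i* 0 :> R[i].
Proof.
elim: m => [//|m IH]; rewrite !mulrS IH.
by apply/eqP; rewrite eq_complex/= addr0 !eqxx.
Qed.

(** The remainder of the second-order Taylor expansion of the power [n.+2] at [z] with increment
    [w]. *)
Definition rem2 (C : comNzRingType) n (z w : C) : C :=
  (z + w) ^+ n.+2 - z ^+ n.+2 - (z ^+ n.+1 * n.+2%:R) * w - (z ^+ n * 'C(n.+2, 2)%:R) * w ^+ 2.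

(** Multiplying the expansion by [z + w] creates just one new term beyond second order, by Pascal's
    rule. As the remainder is zero for squares, this recursion shows that it is cubic in [w]. *)
Lemma rem2S (C : comNzRingType) n (z w : C) :
  rem2 C n.+1 z w = (z + w) * rem2 C n z w + (z ^+ n * 'C(n.+2, 2)%:R) * w ^+ 3.
Proof.
have gen (A B c1 c2 : C) :
  (z + w) * A - z * (z * (z * B)) - (z * (z * B)) * (1 + c1) * w - (z * B) * (c2 + c1) * w ^+ 2 =
  (z + w) * (A - z * (z * B) - (z * B) * c1 * w - B * c2 * w ^+ 2) + B * c2 * w ^+ 3.
  by ring.
rewrite /rem2 (binS n.+2 1) bin1 natrD (exprS (z + w) n.+2).
by rewrite (exprS z n.+2) (exprS z n.+1) (exprS z n) -gen (mulrS 1 n.+2).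
Qed.

Lemma rem2_le n (M : R) : 0 <= M -> exists2 K, 0 <= K &
  forall z w, l1 z <= M -> l1 w <= 2 -> l1 (rem2 _ n z w) <= K * l1 w ^+ 3.
Proof.
move=> M0; elim: n => [|n [K K0 IH]].
  exists 0 => // z w _ _; rewrite /rem2 expr0 expr1.
  have -> : (z + w) ^+ 2 - z ^+ 2 - z * 2 * w - 1 * 'C(2, 2)%:R * w ^+ 2 = 0.
    by rewrite binn; ring.
  by rewrite mul0r /l1/= normr0 addr0.
exists ((M + 2) * K + M ^+ n * 'C(n.+2, 2)%:R).
  by rewrite addr_ge0 ?mulr_ge0 ?addr_ge0// ?mulr_ge0// exprn_ge0.
move=> z w zM w2; rewrite rem2S (le_trans (l1D _ _))// [leRHS]mulrDl lerD//.
  rewrite (le_trans (l1M _ _))// -mulrA ler_pM ?l1_ge0//; last exact: IH.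
  by rewrite (le_trans (l1D _ _))// lerD.
rewrite (le_trans (l1M _ _))// ler_pM ?l1_ge0// ?l1X//.
rewrite (le_trans (l1Mn _ _))// ler_wpM2r//.
by rewrite (le_trans (l1X _ _))// lerXn2r ?nnegrE ?l1_ge0.
Qed.

Lemma zpow_le n x y : `|zpow n x y| <= 2 ^+ n * (`|x| ^+ n + `|y| ^+ n).
Proof.
rewrite /zpow; apply: (@le_trans _ _ (l1 ((x +i* y) ^+ n))); first by rewrite lerDl.
rewrite (le_trans (l1X _ _))// /l1/=.
wlog xy : x y / `|x| <= `|y|.
  by move=> h; have [/h//|/ltW/h] := leP `|x| `|y|; rewrite addrC (addrC (_ ^+ n)).
apply: (@le_trans _ _ ((2 * `|y|) ^+ n)).
  by rewrite lerXn2r ?nnegrE ?addr_ge0 ?mulr_ge0// mulr_natl mulr2n lerD2r.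
by rewrite exprMn ler_wpM2l ?exprn_ge0// lerDr exprn_ge0.
Qed.

(** Locally bounded Borel functions: evaluated at the present state and cut off outside a box, they
    are bounded multipliers measurable with respect to the past. *)
Definition tame (h : R -> R -> R) :=
  (forall M : R, exists2 K, 0 <= K & forall x y, `|x| <= M -> `|y| <= M -> `|h x y| <= K) /\
  measurable_fun setT (fun z : R * R => h z.1 z.2).

Lemma tame_cst (c : R) : tame (fun _ _ => c).
Proof. by split; [move=> M; exists (Num.norm c)|exact: measurable_cst]. Qed.

Lemma tame_fst : tame (fun x _ => x).
Proof.
split; last exact: measurable_fst.
by move=> M; exists (Num.norm M) => // x y /le_trans + _; apply; exact: ler_norm.
Qed.

Lemma tame_snd : tame (fun _ y => y).
Proof.
split; last exact: measurable_snd.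
by move=> M; exists (Num.norm M) => // x y _ /le_trans; apply; exact: ler_norm.
Qed.

Lemma tameD f g : tame f -> tame g -> tame (fun x y => f x y + g x y).
Proof.
move=> [fb fm] [gb gm]; split; last exact: measurable_funD.
move=> M; have [K K0 fK] := fb M; have [L L0 gL] := gb M.
exists (K + L); first exact: addr_ge0.
by move=> x y xM yM; rewrite (le_trans (ler_normD _ _))// lerD ?fK ?gL.
Qed.

Lemma tameM f g : tame f -> tame g -> tame (fun x y => f x y * g x y).
Proof.
move=> [fb fm] [gb gm]; split; last exact: measurable_funM.
move=> M; have [K K0 fK] := fb M; have [L L0 gL] := gb M.
exists (K * L); first exact: mulr_ge0.
by move=> x y xM yM; rewrite normrM ler_pM ?fK ?gL.
Qed.

Lemma tameN f : tame f -> tame (fun x y => - f x y).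
Proof.
move=> tf; have := tameM _ _ (tame_cst (-1)) tf.
by under eq_fun do under eq_fun do rewrite mulN1r.
Qed.

Lemma tame_pow n : tame (zpow n) /\ tame (fun x y => complex.Im ((x +i* y) ^+ n)).
Proof.
elim: n => [|n [rn im]]; first by split; exact: tame_cst.
have eR : zpow n.+1 = (fun x y => x * zpow n x y + - (y * complex.Im ((x +i* y) ^+ n))).
  by apply/funext => x; apply/funext => y; rewrite /zpow exprS; case: (_ ^+ n).
have eI : (fun x y => complex.Im ((x +i* y) ^+ n.+1)) =
    (fun x y => x * complex.Im ((x +i* y) ^+ n) + y * zpow n x y).
  by apply/funext => x; apply/funext => y; rewrite /zpow exprS; case: (_ ^+ n).
rewrite eR eI; split; apply: tameD; rewrite ?tameN//.
- exact: tameM tame_fst rn.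
- exact/tameN/(tameM _ _ tame_snd im).
- exact: tameM tame_fst im.
- exact: tameM tame_snd rn.
Qed.

Lemma ler_1DX n x : 0 <= x -> forall m, (m <= n)%N -> x ^+ m <= 1 + x ^+ n.
Proof.
move=> x0 m mn; have [x1|x1] := leP x 1.
  by apply: (@le_trans _ _ 1); rewrite ?exprn_ile1// lerDl exprn_ge0.
by apply: (@le_trans _ _ (x ^+ n)); rewrite ?lerDr// ler_weXn2l// ltW.
Qed.

                                                                                
                                                                      
(** The four coefficients multiply increments of [x], [y], [x^2 - y^2] and [xy], the four
    martingales of a conformal pair. The first bound on the remainder serves small increments, the
    second one the rare large increments. *)
Lemma zpow_expansion n : exists h1 h2 h3 h4 : R -> R -> R,
  [/\ tame h1, tame h2, tame h3, tame h4 & forall M : R, exists2 K, 0 <= K &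
   forall x y x' y', `|x| <= M -> `|y| <= M ->
   let r := zpow n.+2 x' y' - zpow n.+2 x y
     - (h1 x y * (x' - x) + h2 x y * (y' - y) +
        h3 x y * ((x' ^+ 2 - y' ^+ 2) - (x ^+ 2 - y ^+ 2)) +
        h4 x y * (x' * y' - x * y)) in
   (forall D, D <= 1 -> `|x' - x| <= D -> `|y' - y| <= D ->
     `|r| <= K * D * ((x' - x) ^+ 2 + (y' - y) ^+ 2)) /\
   `|r| <= K * (1 + `|x'| ^+ n.+2 + `|y'| ^+ n.+2)].
Proof.
(* [p + iq] and [r + is] are the Taylor coefficients of [w] and [w^2]; the [h]'s are read off the
   real part after substituting [w^2 = (z'^2 - z^2) - 2zw]. *)
pose p x y := complex.Re ((x +i* y) ^+ n.+1) * n.+2%:R : R.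
pose q x y := complex.Im ((x +i* y) ^+ n.+1) * n.+2%:R : R.
pose r x y := complex.Re ((x +i* y) ^+ n) * 'C(n.+2, 2)%:R : R.
pose s x y := complex.Im ((x +i* y) ^+ n) * 'C(n.+2, 2)%:R : R.
have tp : tame p by exact: tameM (tame_pow n.+1).1 (tame_cst _).
have tq : tame q by exact: tameM (tame_pow n.+1).2 (tame_cst _).
have tr : tame r by exact: tameM (tame_pow n).1 (tame_cst _).
have ts : tame s by exact: tameM (tame_pow n).2 (tame_cst _).
pose h1 x y := p x y + - (2 * (x * r x y)) + 2 * (y * s x y).
pose h2 x y := - q x y + 2 * (y * r x y) + 2 * (x * s x y).
pose h4 x y := - (2 * s x y).
have t1 : tame h1.
  apply: tameD; first apply: tameD => //.
    exact/tameN/(tameM _ _ (tame_cst _) (tameM _ _ tame_fst tr)).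
  exact: (tameM _ _ (tame_cst _) (tameM _ _ tame_snd ts)).
have t2 : tame h2.
  apply: tameD; first apply: tameD; first exact: tameN.
    exact: (tameM _ _ (tame_cst _) (tameM _ _ tame_snd tr)).
  exact: (tameM _ _ (tame_cst _) (tameM _ _ tame_fst ts)).
have t4 : tame h4 by exact/tameN/(tameM _ _ (tame_cst _) ts).
exists h1, h2, r, h4; split => // M.
have [M0|M0] := ltP M 0.
  by exists 0 => // x y x' y' /(le_trans (normr_ge0 _)); rewrite leNgt M0.
have [K K0 remK] := @rem2_le n (M + M) (addr_ge0 M0 M0).
have [K1 K10 h1K] := t1.1 M.
have [K2 K20 h2K] := t2.1 M.
have [K3 K30 h3K] := tr.1 M.
have [K4 K40 h4K] := t4.1 M.
have [Kz Kz0 zK] := (tame_pow n.+2).1.1 M.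
(* [L] adds up crude bounds for the six terms of the remainder, each a constant times
   [1 + |x'|^(n+2) + |y'|^(n+2)]. The factor 4 below comes from [l1 w <= 2D] and
   [(l1 w)^2 <= 2 (u^2 + v^2)]. *)
pose L := 2 ^+ n.+2 + Kz + K1 * (1 + M) + K2 * (1 + M) + K3 * (2 + M ^+ 2 * 2) + K4 * (2 + M ^+ 2).
have p2 : 0 <= 2 ^+ n.+2 :> R by exact: exprn_ge0.
have eM : 0 <= M ^+ 2 by exact: exprn_ge0.
have L0 : 0 <= L by rewrite /L; repeat (done || apply: addr_ge0 || apply: mulr_ge0).
exists (4 * K + L); first by rewrite addr_ge0// mulr_ge0.
move=> x y x' y' xM yM; split.
- move=> D D1 uD vD.
  set u := x' - x in uD *; set v := y' - y in vD *.
  have D0 : 0 <= D := le_trans (normr_ge0 _) uD.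
  rewrite [X in `|X|](_ : _ = complex.Re (rem2 _ n (x +i* y) (u +i* v))); last first.
    rewrite /rem2 /zpow [x +i* y + _](_ : _ = x' +i* y'); last first.
      by apply/eqP; rewrite eq_complex /= /u /v ![_ + (_ - _)]addrC !subrK !eqxx.
    rewrite /h1 /h2 /h4 /p /q /r /s.
    rewrite expr2 !complex_natr.
    move: (_ ^+ n.+2) ((x +i* y) ^+ n.+2) ((x +i* y) ^+ n.+1) ((x +i* y) ^+ n).
    move=> [a1 b1] [a2 b2] [a3 b3] [a4 b4] /=; rewrite /u /v.
    move: (n.+2%:R) ('C(n.+2, 2)%:R) => c1 c2.
    ring.
  apply: (@le_trans _ _ (l1 (rem2 _ n (x +i* y) (u +i* v)))); first by rewrite lerDl.
  have uvD : l1 (u +i* v) <= 2 * D by rewrite /l1/= mulr_natl mulr2n lerD.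
  apply: le_trans (remK _ _ _ _) _.
  - by rewrite /l1/= lerD.
  - by rewrite (le_trans uvD)// ler_piMr.
  rewrite exprS; apply: (@le_trans _ _ (K * (2 * D * (2 * (u ^+ 2 + v ^+ 2))))).
    rewrite ler_wpM2l// ler_pM ?l1_ge0// ?sqr_ge0// /l1/=.
    rewrite -(real_normK (num_real u)) -(real_normK (num_real v)).
    have := sqr_ge0 (`|u| - `|v|); nra.
  have -> : K * (2 * D * (2 * (u ^+ 2 + v ^+ 2))) = 4 * K * D * (u ^+ 2 + v ^+ 2) by ring.
  by rewrite ler_wpM2r ?addr_ge0 ?sqr_ge0// ler_wpM2r// lerDl.
- set W := 1 + _ + _.
  have W1 : 1 <= W by rewrite /W -addrA lerDl addr_ge0 ?exprn_ge0.
  have xW : `|x'| <= W.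
    by rewrite /W -[leLHS]expr1 (le_trans (ler_1DX n.+2 _ (normr_ge0 x') 1 _))// lerDl exprn_ge0.
  have yW : `|y'| <= W.
    rewrite /W -[leLHS]expr1 (le_trans (ler_1DX n.+2 _ (normr_ge0 y') 1 _))//.
    by rewrite addrAC lerDl exprn_ge0.
  have x2W : `|x'| ^+ 2 <= W.
    by rewrite /W (le_trans (ler_1DX n.+2 _ (normr_ge0 x') 2 _))// lerDl exprn_ge0.
  have y2W : `|y'| ^+ 2 <= W.
    rewrite /W (le_trans (ler_1DX n.+2 _ (normr_ge0 y') 2 _))//.
    by rewrite addrAC lerDl exprn_ge0.
  have MM (a b : R) : `|a| <= M -> `|b| <= M -> `|a| * `|b| <= M ^+ 2.
    by move=> aM bM; rewrite expr2 ler_pM.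
  have bnd (k K' a c : R) : 0 <= c -> 0 <= K' -> `|k| <= K' -> `|a| <= c * W -> `|k * a| <= K' * c * W.
    by move=> c0 K'0 kK aw; rewrite normrM -mulrA ler_pM.
  have W0 : 0 <= W by lra.
  have MW : M <= M * W by rewrite ler_peMr.
  have M2 : 0 <= M ^+ 2 by rewrite exprn_ge0.
  have M2W : M ^+ 2 <= M ^+ 2 * W by rewrite ler_peMr.
  have b1 : `|h1 x y * (x' - x)| <= K1 * (1 + M) * W.
    apply: bnd; rewrite ?h1K ?addr_ge0// (le_trans (ler_normB _ _))//; lra.
  have b2 : `|h2 x y * (y' - y)| <= K2 * (1 + M) * W.
    apply: bnd; rewrite ?h2K ?addr_ge0// (le_trans (ler_normB _ _))//; lra.
  have sq (a : R) : `|a ^+ 2| = `|a| ^+ 2 by rewrite normrX.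
  have b3 : `|r x y * ((x' ^+ 2 - y' ^+ 2) - (x ^+ 2 - y ^+ 2))| <= K3 * (2 + M ^+ 2 * 2) * W.
    apply: bnd; rewrite ?h3K ?addr_ge0 ?mulr_ge0// (le_trans (ler_normB _ _))//.
    have := ler_normB (x' ^+ 2) (y' ^+ 2); have := ler_normB (x ^+ 2) (y ^+ 2).
    rewrite !sq; have := MM _ _ xM xM; have := MM _ _ yM yM; rewrite -!expr2; lra.
  have b4 : `|h4 x y * (x' * y' - x * y)| <= K4 * (2 + M ^+ 2) * W.
    apply: bnd; rewrite ?h4K ?addr_ge0// (le_trans (ler_normB _ _))// !normrM.
    have := MM _ _ xM yM; have := sqr_ge0 (`|x'| - `|y'|); nra.
  have b5 : `|zpow n.+2 x' y'| <= 2 ^+ n.+2 * W.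
    by rewrite (le_trans (zpow_le _ _ _))// ler_wpM2l ?exprn_ge0// /W -addrA lerDr.
  have b6 : `|zpow n.+2 x y| <= Kz * W.
    by rewrite (le_trans (zK _ _ xM yM))// ler_peMr.
  apply: (@le_trans _ _ (L * W)); last by rewrite ler_wpM2r// lerDr mulr_ge0.
  rewrite (le_trans (ler_normB _ _))//.
  have := ler_normB (zpow n.+2 x' y') (zpow n.+2 x y).
  move: b1 b2 b3 b4 b5 b6.
  move: (zpow n.+2 x' y') (zpow n.+2 x y) (h1 x y * _) (h2 x y * _) (r x y * _) (h4 x y * _).
  move=> z1 z2 e1 e2 e3 e4.
  have := ler_normD (e1 + e2 + e3) e4; have := ler_normD (e1 + e2) e3; have := ler_normD e1 e2.
  move=> *; rewrite /L !mulrDl; lra.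
Qed.
End Remainder.

                                       

(** * Expectations, conditioning on a sub-sigma-algebra, submartingale inequality *)

Section Expectation.
Context {d : measure_display} {T : measurableType d} {R : realType}.
Variable P : probability T R.
Implicit Types (f g h : T -> R) (A B : set T) (G : set (set T)).

Definition rintegrable f := P.-integrable setT (EFin \o f).
Definition mean f : R := Rintegral P setT f.

Local Notation E := mean.

Lemma rintegrable_meas f : rintegrable f -> measurable_fun setT f.
Proof. by move=> /measurable_int/measurable_EFinP. Qed.

Lemma rintegrable_le f g : measurable_fun setT f -> rintegrable g ->
  (forall w, `|f w| <= g w) -> rintegrable f.
Proof.
move=> mf ig fg; apply: le_integrable ig => //; first exact/measurable_EFinP.
by move=> w _; rewrite lee_fin (le_trans (fg w))// ler_norm.
Qed.

Lemma rintegrableD f g : rintegrable f -> rintegrable g -> rintegrable (fun w => f w + g w).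
Proof. by move=> fi gi; have := integrableD measurableT fi gi. Qed.

Lemma rintegrableB f g : rintegrable f -> rintegrable g -> rintegrable (fun w => f w - g w).
Proof. by move=> fi gi; have := integrableB measurableT fi gi. Qed.

Lemma rintegrableZ c f : rintegrable f -> rintegrable (fun w => c * f w).
Proof. by move=> fi; have := integrableZl measurableT c fi. Qed.

Lemma rintegrable_norm f : rintegrable f -> rintegrable (fun w => `|f w|).
Proof. by move/integrable_norm. Qed.

Lemma rintegrable_cst c : rintegrable (fun=> c).
Proof. exact: finite_measure_integrable_cst. Qed.

Lemma rintegrable_bounded K h f : measurable_fun setT h -> (forall w, `|h w| <= K) -> rintegrable f ->
  rintegrable (fun w => h w * f w).
Proof.
move=> mh hK fi; apply: (@rintegrable_le _ (fun w => K * `|f w|)).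
- by apply: measurable_funM => //; exact: rintegrable_meas.
- exact/rintegrableZ/rintegrable_norm.
- by move=> w; rewrite normrM ler_wpM2r.
Qed.

Lemma rintegrable_indic f A : measurable A -> rintegrable f -> rintegrable (fun w => f w * \1_A w).
Proof.
move=> mA fi; under eq_fun do rewrite mulrC.
apply: (@rintegrable_bounded 1) => //.
by move=> w; rewrite ger0_norm// indicE; case: (_ \in _).
Qed.

Lemma meanD f g : rintegrable f -> rintegrable g -> E (fun w => f w + g w) = E f + E g.
Proof. exact: RintegralD. Qed.

Lemma meanB f g : rintegrable f -> rintegrable g -> E (fun w => f w - g w) = E f - E g.
Proof. exact: RintegralB. Qed.

Lemma meanZ c f : rintegrable f -> E (fun w => c * f w) = c * E f.
Proof. exact: RintegralZl. Qed.

Lemma mean_le f g : rintegrable f -> rintegrable g -> (forall w, f w <= g w) -> E f <= E g.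
Proof. by move=> fi gi fg; apply: le_Rintegral. Qed.

Lemma mean_ge0 f : (forall w, 0 <= f w) -> 0 <= E f.
Proof. by move=> f0; apply: Rintegral_ge0. Qed.

Lemma norm_mean_le f : rintegrable f -> `|E f| <= E (fun w => `|f w|).
Proof. exact: le_normr_Rintegral. Qed.

Lemma mean_norm_le f g : rintegrable f -> rintegrable g -> (forall w, `|f w| <= g w) -> `|E f| <= E g.
Proof.
move=> fi gi fg; apply: (le_trans (norm_mean_le _ fi)).
by apply: mean_le => //; exact: rintegrable_norm.
Qed.

Lemma mean_indic f A : E (fun w => f w * \1_A w) = \int[P]_(w in A) f w.
Proof. by rewrite [RHS]Rintegral_mkcond patch_indic. Qed.

(** Dominated convergence: every point leaves the sets [B m] for good, so [f] times their indicators
    tends to zero under the majorant [f]. *)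
Lemma mean_vanishing f (B : nat -> set T) : rintegrable f -> (forall w, 0 <= f w) ->
  (forall m, measurable (B m)) ->
  (forall w, exists m0, forall m, (m0 <= m)%N -> ~ B m w) ->
  forall e, 0 < e -> exists m, E (fun w => f w * \1_(B m) w) < e.
Proof.
move=> fi f0 mB Bv e e0.
pose fn m w := (f w * \1_(B m) w)%:E.
have mfn m : measurable_fun setT (fn m).
  by apply/measurable_EFinP; apply/rintegrable_meas/rintegrable_indic.
have cv : \forall w \ae P, setT w -> fn ^~ w @ \oo --> (cst 0%E : T -> \bar R) w.
  apply: aeW => w _; apply: cvg_near_cst.
  have [m0 m0P] := Bv w.
  by exists m0 => // m /= mm0; rewrite /fn indicE memNset ?mulr0//; exact: m0P.
have dom : \forall w \ae P, forall n, setT w -> (`|fn n w| <= (EFin \o f) w)%E.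
  apply: aeW => w n _; rewrite lee_fin ger0_norm ?mulr_ge0//.
  by rewrite ler_piMr// indicE; case: (_ \in _).
have [_ _] := dominated_convergence measurableT mfn (measurable_cst _) cv fi dom.
rewrite integral0 => /fine_cvgP[_ /cvgrPdist_lt/(_ _ e0)[m _ /(_ m (leqnn m))]] /=.
rewrite sub0r normrN => h; exists m.
exact: le_lt_trans (ler_norm _) h.
Qed.

Definition sub_algebra G := sigma_algebra setT G /\ G `<=` measurable.

(** Measurability with respect to [G], phrased on the type carrying the generated sigma-algebra so
    that the closure properties of [measurable_fun] apply; by [gmeasurableP] it agrees with the
    preimage condition. *)
Definition gmeasurable G h := measurable_fun (setT : set (g_sigma_algebraType G)) h.

Lemma gmeasurableP G h : sub_algebra G ->
  (forall B : set R, measurable B -> G (h @^-1` B)) <-> gmeasurable G h.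
Proof.
move=> [sG GM]; split => [H _ B mB|H B mB].
  by rewrite setTI measurable_g_measurableTypeE//; exact: H.
have := H measurableT B mB.
by rewrite setTI measurable_g_measurableTypeE.
Qed.

Lemma gmeasurable_sub G G' h : sub_algebra G -> sub_algebra G' -> G `<=` G' ->
  gmeasurable G h -> gmeasurable G' h.
Proof. by move=> sG sG' GG' /(gmeasurableP _ _ sG) H; apply/(gmeasurableP _ _ sG') => B /H/GG'. Qed.

Lemma gmeasurable_meas G h : sub_algebra G -> gmeasurable G h -> measurable_fun setT h.
Proof. by move=> sG /(gmeasurableP _ _ sG) H _ B /H/(sG.2); rewrite setTI. Qed.

Lemma gmeasurable_set G A : sub_algebra G -> G A -> (measurable : set (set (g_sigma_algebraType G))) A.
Proof. by move=> sG GA; rewrite measurable_g_measurableTypeE//; case: sG. Qed.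

Lemma gmeasurable_set_inv G A : sub_algebra G -> (measurable : set (set (g_sigma_algebraType G))) A -> G A.
Proof. by move=> sG; rewrite measurable_g_measurableTypeE//; case: sG. Qed.

Lemma gmeasurable_indic G A : sub_algebra G -> G A -> gmeasurable G (\1_A).
Proof. by move=> sG /(gmeasurable_set _ _ sG) mA; exact: measurable_indic. Qed.

(** This encodes that the conditional expectation of [f] given [G] is zero. *)
Definition cond_mean0 G f := rintegrable f /\ forall A, G A -> E (fun w => f w * \1_A w) = 0.

                                                                             
                      
(** Bisection of the range: subtracting [K / 2] on the event [g >= K / 2], which lies in [G], leaves
    the mean of [g f] unchanged and halves the bound on [g]. *)
Lemma cond_mean0_bounded_aux G f n K g : sub_algebra G -> cond_mean0 G f -> gmeasurable G g ->
  (forall w, 0 <= g w <= K) ->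
  `|E (fun w => g w * f w)| <= K / 2 ^+ n * E (fun w => `|f w|).
Proof.
move=> sG [fi f0]; elim: n K g => [|n IH] K g mg gK.
  rewrite expr0 divr1 -meanZ; last exact: rintegrable_norm.
  have K0 w : `|g w| <= K by have /andP[g0 ?] := gK w; rewrite ger0_norm.
  apply: mean_norm_le.
  - by apply: (@rintegrable_bounded K) => //; exact: gmeasurable_meas mg.
  - exact/rintegrableZ/rintegrable_norm.
  - by move=> w; rewrite normrM ler_wpM2r.
pose A := g @^-1` `[K / 2, +oo[.
have GA : G A by apply: (proj2 (gmeasurableP _ _ sG) mg); exact: measurable_itv.
pose g' w := g w - (K / 2) * \1_A w.
have mg' : gmeasurable G g'.
  apply: measurable_funB => //; apply: measurable_funM => //.
  exact: gmeasurable_indic.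
have g'K w : 0 <= g' w <= K / 2.
  have /andP[g0 gk] := gK w.
  rewrite /g' indicE; have [/set_mem|/negP nA] := boolP (w \in A).
    by rewrite /A/= in_itv/= andbT => ?; rewrite mulr1; lra.
  have : ~ A w by move=> /mem_set.
  by rewrite /A/= in_itv/= andbT => /negP; rewrite -ltNge => ?; rewrite mulr0; lra.
have := IH _ _ mg' g'K.
suff -> : E (fun w => g' w * f w) = E (fun w => g w * f w).
  by rewrite exprS invfM mulrA.
have mA : measurable A by exact: sG.2.
rewrite (_ : (fun w => g' w * f w) = (fun w => g w * f w - K / 2 * (f w * \1_A w))); last first.
  by apply/funext => w; rewrite /g'; ring.
have K0 w : `|g w| <= K by have /andP[g0 ?] := gK w; rewrite ger0_norm.
have gfi : rintegrable (fun w => g w * f w).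
  by apply: (@rintegrable_bounded K) => //; exact: gmeasurable_meas mg.
have fAi := rintegrable_indic _ _ mA fi.
by rewrite meanB//; [rewrite meanZ// f0// mulr0 subr0|exact: rintegrableZ].
Qed.

Lemma cond_mean0_bounded G f K g : sub_algebra G -> cond_mean0 G f -> gmeasurable G g ->
  (forall w, `|g w| <= K) -> E (fun w => g w * f w) = 0.
Proof.
move=> sG cf mg gK.
(* The shift makes [g] nonnegative and does not change the mean, since [f] itself has mean zero;
   then [n] tends to infinity in the bisection bound. *)
pose g' w := g w + K.
have mg' : gmeasurable G g' by exact: measurable_funD.
have g'K w : 0 <= g' w <= 2 * K.
  by have := gK w; rewrite ler_norml /g' => /andP[? ?]; lra.
have e w : g' w * f w = g w * f w + K * f w by rewrite /g' mulrDl.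
have [fi f0] := cf.
have gfi : rintegrable (fun w => g w * f w).
  by apply: (@rintegrable_bounded K) => //; exact: gmeasurable_meas mg.
have EE : E (fun w => g' w * f w) = E (fun w => g w * f w).
  under [in LHS]eq_fun do rewrite e.
  rewrite meanD//; last exact: rintegrableZ.
  rewrite meanZ//.
  have := f0 setT; under eq_fun do rewrite indicT mulr1.
  move=> ->; first by rewrite mulr0 addr0.
  by case: sG => -[G0 GC _] _; rewrite -(setD0 setT); exact: GC.
apply/eqP; rewrite -normr_eq0; apply/eqP/le_anti; rewrite normr_ge0 andbT -EE.
set c := 2 * K * E (fun w => `|f w|).
have H n : `|E (fun w => g' w * f w)| <= c / 2 ^+ n.
  by rewrite /c mulrAC; exact: (cond_mean0_bounded_aux G).
rewrite leNgt; apply/negP => a0.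
set a := `|_| in a0 H.
have [n nP] : exists n, c / a < 2 ^+ n.
  exists (Num.trunc (c / a)).+1.
  apply: (lt_trans (truncnS_gt (c / a))).
  by rewrite -natrX ltr_nat ltn_expl.
have := H n; rewrite leNgt => /negP; apply.
by rewrite ltr_pdivrMr ?exprn_gt0// mulrC -ltr_pdivrMr.
Qed.

Lemma pow_tangent (x y : R) n : 0 <= x -> 0 <= y ->
  x ^+ n + n%:R * x ^+ n.-1 * (y - x) <= y ^+ n.
Proof.
move=> x0 y0; elim: n => [|n IH]; first by rewrite !expr0 !mul0r addr0.
have := ler_wpM2l y0 IH; rewrite -exprS; apply: le_trans.
rewrite -subr_ge0 /=.
case: n {IH} => [|n].
  rewrite expr0 expr1 !mul0r; lra.
have -> : y * (x ^+ n.+1 + n.+1%:R * x ^+ n.+1.-1 * (y - x)) -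
  (x ^+ n.+2 + n.+2%:R * x ^+ n.+1 * (y - x)) = n.+1%:R * x ^+ n * (y - x) ^+ 2.
  by rewrite /= (mulrS 1 n.+1) !(exprS x); ring.
by rewrite mulr_ge0 ?sqr_ge0// mulr_ge0// exprn_ge0.
Qed.

Lemma even_pow_tangent (x y : R) n : ~~ odd n ->
  x ^+ n + n%:R * x ^+ n.-1 * (y - x) <= y ^+ n.
Proof.
case: n => [|n] en; first by rewrite !expr0 !mul0r addr0.
have pe (z : R) : z ^+ n.+1 = `|z| ^+ n.+1 by rewrite -normrX ger0_norm// exprn_even_ge0.
rewrite pe [leRHS]pe; apply: le_trans (pow_tangent _ _ n.+1 (normr_ge0 x) (normr_ge0 y)).
rewrite lerD2l/= -!mulrA ler_wpM2l// !mulrBr -!exprSr -pe lerD2r.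
by rewrite -normrX -normrM ler_norm.
Qed.

                                                                            
(** Jensen's inequality through the tangent line at [xs]: its slope is measurable with respect to
    [G], so the linear term has mean zero wherever the slope is bounded. *)
Lemma submartingale_even_pow G (xs xt : T -> R) n A : ~~ odd n -> sub_algebra G ->
  gmeasurable G xs -> cond_mean0 G (fun w => xt w - xs w) ->
  rintegrable (fun w => xs w ^+ n) -> rintegrable (fun w => xt w ^+ n) -> G A ->
  E (fun w => xs w ^+ n * \1_A w) <= E (fun w => xt w ^+ n * \1_A w).
Proof.
move=> en sG mxs c0 xsi xti GA.
have mA : measurable A by exact: sG.2.
apply/ler_addgt0Pr => e e0.
(* Truncation to [|xs| <= m] keeps the slope bounded; the part of the mean lost on [B m] is less
   than [e]. *)
pose B m := xs @^-1` (~` `[- m%:R, m%:R]).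
have GB m : G (B m) by apply: (proj2 (gmeasurableP _ _ sG) mxs); apply: measurableC; exact: measurable_itv.
have mB m : measurable (B m) by apply: sG.2.
have xs0 w : 0 <= xs w ^+ n by rewrite exprn_even_ge0.
have xt0 w : 0 <= xt w ^+ n by rewrite exprn_even_ge0.
have [m mP] : exists m, E (fun w => xs w ^+ n * \1_(B m) w) < e.
  apply: mean_vanishing => // w.
  exists (Num.trunc `|xs w|).+1 => m mm; rewrite /B/= in_itv/= -ler_norml; apply.
  by rewrite ltW// (lt_le_trans (truncnS_gt _))// ler_nat.
pose C := A `&` ~` B m.
have GC : G C.
  apply: gmeasurable_set_inv => //; apply: measurableI; first exact: gmeasurable_set.
  by apply: measurableC; exact: gmeasurable_set.
have mC : measurable C by exact: sG.2.
have xsC w : w \in C -> `|xs w| <= m%:R.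
  by move=> /set_mem[_ /=]; rewrite /B/= in_itv/= => /contrapT; rewrite -ler_norml.
pose h w := \1_C w * (n%:R * xs w ^+ n.-1).
have mh : gmeasurable G h.
  apply: measurable_funM; first exact: gmeasurable_indic.
  by apply: measurable_funM => //; exact: measurable_funX.
have hK w : `|h w| <= n%:R * m%:R ^+ n.-1.
  rewrite /h indicE; have [wC|wC] := boolP (w \in C); last first.
    by rewrite mul0r normr0 mulr_ge0// exprn_ge0.
  by rewrite mul1r normrM normr_nat ler_wpM2l// normrX lerXn2r ?nnegrE// xsC.
have H0 := @cond_mean0_bounded G _ _ h sG c0 mh hK.
have [ci _] := c0.
apply: (@le_trans _ _ (E (fun w => xs w ^+ n * \1_C w + xs w ^+ n * \1_(B m) w))).
  apply: mean_le; [exact: rintegrable_indic|apply: rintegrableD; exact: rintegrable_indic|].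
  move=> w; rewrite -mulrDr ler_wpM2l// /C !indicE in_setI in_setC.
  by case: (w \in A) => /=; case: (w \in B m) => /=; rewrite ?addr0 ?add0r.
rewrite meanD; [|exact: rintegrable_indic..].
rewrite lerD ?(ltW mP)//.
rewrite -[leLHS]addr0 -H0 -meanD; [|exact: rintegrable_indic|]; last first.
  by apply: rintegrable_bounded ci; [exact: gmeasurable_meas mh|exact: hK].
apply: mean_le; [|exact: rintegrable_indic|].
  apply: rintegrableD; first exact: rintegrable_indic.
  by apply: rintegrable_bounded ci; [exact: gmeasurable_meas mh|exact: hK].
move=> w; rewrite /h.
have -> : xs w ^+ n * \1_C w + \1_C w * (n%:R * xs w ^+ n.-1) * (xt w - xs w) =
  (xs w ^+ n + n%:R * xs w ^+ n.-1 * (xt w - xs w)) * \1_C w by ring.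
apply: (@le_trans _ _ (xt w ^+ n * \1_C w)).
  by rewrite ler_wpM2r// even_pow_tangent.
by rewrite ler_wpM2l// /C !indicE in_setI; case: (_ \in A); case: (_ \in ~` _).
Qed.
End Expectation.

                      

(** * The discrete-time estimate for a stopped conformal pair *)

Section Discrete.
Local Open Scope complex_scope.
Context {d : measure_display} {T : measurableType d} {R : realType}.
Variable P : probability T R.
Local Notation rintegrable := (rintegrable P).
Local Notation E := (mean P).
Local Notation cond_mean0 := (cond_mean0 P).

Lemma gmeasurable_tame (G : set (set T)) (h : R -> R -> R) (x y : T -> R) :
  tame h -> gmeasurable G x -> gmeasurable G y -> gmeasurable G (fun w => h (x w) (y w)).
Proof.
move=> [_ mh] mx my.
exact: (measurableT_comp mh (measurable_fun_pair mx my)).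
Qed.

Lemma rintegrable_pow_le (f : T -> R) m n : (m <= n)%N -> measurable_fun setT f ->
  rintegrable (fun w => f w ^+ n) -> rintegrable (fun w => `|f w| ^+ m).
Proof.
move=> mn mf fi; apply: (@rintegrable_le _ _ _ P _ (fun w => 1 + `|f w ^+ n|)).
- by apply: measurable_funX; exact: measurableT_comp.
- by apply: rintegrableD; [exact: rintegrable_cst|exact: rintegrable_norm].
- by move=> w; rewrite normrX normr_id normrX ler_1DX.
Qed.

Lemma rintegrable_prod2 (f g : T -> R) n : measurable_fun setT f -> measurable_fun setT g ->
  rintegrable (fun w => f w ^+ n.+2) -> rintegrable (fun w => g w ^+ n.+2) ->
  rintegrable (fun w => f w * g w).
Proof.
move=> mf mg fi gi; apply: (@rintegrable_le _ _ _ P _ (fun w => `|f w| ^+ 2 + `|g w| ^+ 2)).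
- exact: measurable_funM.
- by apply: rintegrableD; apply: (@rintegrable_pow_le _ _ n.+2).
- move=> w; rewrite normrM; have := sqr_ge0 (`|f w| - `|g w|).
  have := normr_ge0 (f w); have := normr_ge0 (g w); nra.
Qed.

Lemma rintegrable_zpow (f g : T -> R) n : measurable_fun setT f -> measurable_fun setT g ->
  rintegrable (fun w => f w ^+ n) -> rintegrable (fun w => g w ^+ n) ->
  rintegrable (fun w => zpow n (f w) (g w)).
Proof.
move=> mf mg fi gi.
apply: (@rintegrable_le _ _ _ P _ (fun w => 2 ^+ n * (`|f w ^+ n| + `|g w ^+ n|))).
- exact: (measurableT_comp (tame_pow n).1.2 (measurable_fun_pair mf mg)).
- by apply/rintegrableZ/rintegrableD; exact: rintegrable_norm.
- by move=> w; rewrite (le_trans (zpow_le _ _ _))// !normrX.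
Qed.

Lemma indic01 (A : set T) w : 0 <= (\1_A w : R) <= 1.
Proof. by rewrite indicE; case: (_ \in _); rewrite ?lexx ?ler01. Qed.

Lemma mean_stopped0 (G : set (set T)) (h : R -> R -> R) (x y f : T -> R) M A :
  sub_algebra G -> tame h -> gmeasurable G x -> gmeasurable G y -> cond_mean0 G f -> G A ->
  (forall w, A w -> `|x w| <= M /\ `|y w| <= M) ->
  rintegrable (fun w => h (x w) (y w) * f w * \1_A w) /\
  E (fun w => h (x w) (y w) * f w * \1_A w) = 0.
Proof.
move=> sG th mx my cf GA AM.
have [K K0 hK] := th.1 M.
have mg : gmeasurable G (fun w => \1_A w * h (x w) (y w)).
  by apply: measurable_funM; [exact: gmeasurable_indic|exact: gmeasurable_tame].
have gK w : `|\1_A w * h (x w) (y w)| <= K.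
  rewrite indicE; have [/set_mem/AM[xM yM]|_] := boolP (w \in A).
    by rewrite mul1r hK.
  by rewrite mul0r normr0.
have e w : h (x w) (y w) * f w * \1_A w = \1_A w * h (x w) (y w) * f w by ring.
under eq_fun do rewrite e; split; last exact: (cond_mean0_bounded _ _ _ _ _ sG cf mg gK).
by apply: rintegrable_bounded gK cf.1; exact: gmeasurable_meas mg.
Qed.

(** Orthogonality of increments on [A], where the cross term has a bounded factor and so mean zero;
    on the complement of [A] the difference of second moments is nonnegative by the submartingale
    inequality. *)
Lemma mean_increment_sq (G : set (set T)) (xs xt : T -> R) M A : sub_algebra G ->
  gmeasurable G xs -> cond_mean0 G (fun w => xt w - xs w) ->
  rintegrable (fun w => xs w ^+ 2) -> rintegrable (fun w => xt w ^+ 2) -> G A ->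
  (forall w, A w -> `|xs w| <= M) ->
  rintegrable (fun w => (xt w - xs w) ^+ 2 * \1_A w) /\
  E (fun w => (xt w - xs w) ^+ 2 * \1_A w) <=
    E (fun w => xt w ^+ 2) - E (fun w => xs w ^+ 2).
Proof.
move=> sG mxs c0 xsi xti GA AM.
have GC : G (~` A) by rewrite -setTD; case: sG => -[_ + _] _; exact.
have mA : measurable A by exact: sG.2.
have mC : measurable (~` A) by exact: sG.2.
have [ri r0] := @mean_stopped0 G (fun x _ => x) xs xs _ M A sG tame_fst mxs mxs c0 GA
  (fun w Aw => conj (AM w Aw) (AM w Aw)).
have sub := @submartingale_even_pow _ _ _ P G xs xt 2 _ isT sG mxs c0 xsi xti GC.
have e : (fun w => (xt w - xs w) ^+ 2 * \1_A w) =
   (fun w => (xt w ^+ 2 - xs w ^+ 2) - (xt w ^+ 2 * \1_(~` A) w - xs w ^+ 2 * \1_(~` A) w)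
      - 2 * (xs w * (xt w - xs w) * \1_A w)).
  apply/funext => w; rewrite !indicE in_setC; case: (w \in A) => /=; ring.
rewrite e.
have i1 : rintegrable (fun w => xt w ^+ 2 - xs w ^+ 2) by exact: rintegrableB.
have i2 : rintegrable (fun w => xt w ^+ 2 * \1_(~` A) w) by exact: rintegrable_indic.
have i3 : rintegrable (fun w => xs w ^+ 2 * \1_(~` A) w) by exact: rintegrable_indic.
have i4 := rintegrableB _ _ _ i2 i3.
have i5 := rintegrableB _ _ _ i1 i4.
have i6 := rintegrableZ _ 2 _ ri.
split; first exact: rintegrableB.
by rewrite meanB// meanZ// r0 mulr0 subr0 meanB// meanB// meanB// gerBl subr_ge0.
Qed.

Variables (G : nat -> set (set T)) (x y : nat -> T -> R) (p : nat).
Hypothesis sG : forall i, sub_algebra (G i).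
Hypothesis Gmono : forall i j, (i <= j)%N -> G i `<=` G j.
Hypothesis mx : forall i, gmeasurable (G i) (x i).
Hypothesis my : forall i, gmeasurable (G i) (y i).
Hypothesis cx : forall i j, (i <= j)%N -> cond_mean0 (G i) (fun w => x j w - x i w).
Hypothesis cy : forall i j, (i <= j)%N -> cond_mean0 (G i) (fun w => y j w - y i w).
Hypothesis cu : forall i, cond_mean0 (G i)
  (fun w => (x i.+1 w ^+ 2 - y i.+1 w ^+ 2) - (x i w ^+ 2 - y i w ^+ 2)).
Hypothesis cv : forall i, cond_mean0 (G i) (fun w => x i.+1 w * y i.+1 w - x i w * y i w).
Hypothesis ep : ~~ odd p.
Hypothesis ix : forall i, rintegrable (fun w => x i w ^+ p.+2).
Hypothesis iy : forall i, rintegrable (fun w => y i w ^+ p.+2).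
Hypothesis x0 : forall w, x 0 w = 0.
Hypothesis y0 : forall w, y 0 w = 0.

Let en : ~~ odd p.+2. Proof. by rewrite /= negbK. Qed.
Let powE (z : R) : `|z| ^+ p.+2 = z ^+ p.+2.
Proof. by rewrite -normrX ger0_norm// exprn_even_ge0. Qed.
Let pow0 (z : R) : 0 <= z ^+ p.+2. Proof. by rewrite exprn_even_ge0. Qed.

Let mxT i : measurable_fun setT (x i). Proof. exact: gmeasurable_meas (mx i). Qed.
Let myT i : measurable_fun setT (y i). Proof. exact: gmeasurable_meas (my i). Qed.

Let x2i i : rintegrable (fun w => x i w ^+ 2).
Proof. by have := rintegrable_prod2 _ _ _ (mxT i) (mxT i) (ix i) (ix i). Qed.
Let y2i i : rintegrable (fun w => y i w ^+ 2).
Proof. by have := rintegrable_prod2 _ _ _ (myT i) (myT i) (iy i) (iy i). Qed.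

Let f i w := zpow p.+2 (x i w) (y i w).

Let fle i w : `|f i w| <= 2 ^+ p.+2 * (x i w ^+ p.+2 + y i w ^+ p.+2).
Proof. by rewrite (le_trans (zpow_le _ _ _))// !powE. Qed.

Let fi i : rintegrable (f i). Proof. exact: rintegrable_zpow. Qed.

Variables (N : nat) (M D K : R) (h1 h2 h3 h4 : R -> R -> R).
Hypotheses (t1 : tame h1) (t2 : tame h2) (t3 : tame h3) (t4 : tame h4).
Hypotheses (M0 : 0 <= M) (D0 : 0 <= D) (D1 : D <= 1) (K0 : 0 <= K).
Hypothesis expansion : forall x y x' y', `|x| <= M -> `|y| <= M ->
   let r := zpow p.+2 x' y' - zpow p.+2 x y
     - (h1 x y * (x' - x) + h2 x y * (y' - y) +
        h3 x y * ((x' ^+ 2 - y' ^+ 2) - (x ^+ 2 - y ^+ 2)) +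
        h4 x y * (x' * y' - x * y)) in
   (forall D, D <= 1 -> `|x' - x| <= D -> `|y' - y| <= D ->
     `|r| <= K * D * ((x' - x) ^+ 2 + (y' - y) ^+ 2)) /\
   `|r| <= K * (1 + `|x'| ^+ p.+2 + `|y'| ^+ p.+2).

Let W w := x N w ^+ p.+2 + y N w ^+ p.+2.
Let Wi : rintegrable W. Proof. exact: rintegrableD. Qed.
Let W0 w : 0 <= W w. Proof. by rewrite addr_ge0. Qed.

Let sq i := E (fun w => x i w ^+ 2) + E (fun w => y i w ^+ 2).

Definition jump i : set T :=
  [set w | D < `|x i.+1 w - x i w|] `|` [set w | D < `|y i.+1 w - y i w|].

(** This moves every error term to the one integrable variable [W], independent of the step, so that
    errors on disjoint events can be added. *)
Let mono_W i B : (i <= N)%N -> G i B ->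
  E (fun w => (x i w ^+ p.+2 + y i w ^+ p.+2) * \1_B w) <= E (fun w => W w * \1_B w).
Proof.
move=> iN GB; have mB : measurable B by exact: (sG i).2.
have e (a b : T -> R) : rintegrable a -> rintegrable b -> E (fun w => (a w + b w) * \1_B w) =
    E (fun w => a w * \1_B w) + E (fun w => b w * \1_B w).
  move=> ai bi; rewrite -meanD; [|exact: rintegrable_indic..].
  by congr (mean _ _); apply/funext => w; rewrite mulrDl.
rewrite /W !e// lerD//.
- exact: (submartingale_even_pow _ _ _ _ _ _ en (sG i) (mx i) (cx _ _ iN)).
- exact: (submartingale_even_pow _ _ _ _ _ _ en (sG i) (my i) (cy _ _ iN)).
Qed.

Let jumpG i : G i.+1 (jump i).
Proof.
apply: gmeasurable_set_inv => //.
have mxx : gmeasurable (G i.+1) (x i) by apply: gmeasurable_sub (mx i) => //; exact: Gmono.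
have myy : gmeasurable (G i.+1) (y i) by apply: gmeasurable_sub (my i) => //; exact: Gmono.
have H (a b : T -> R) : gmeasurable (G i.+1) a -> gmeasurable (G i.+1) b ->
    (measurable : set (set (g_sigma_algebraType (G i.+1)))) [set w | D < `|a w - b w|].
  move=> ma mb.
  have : gmeasurable (G i.+1) (fun w => `|a w - b w|).
    by apply: measurableT_comp => //; exact: measurable_funB.
  move=> /(_ measurableT [set` `]D, +oo[] (measurable_itv _)).
  rewrite setTI; congr measurable; apply/seteqP; split => w /=; by rewrite in_itv/= andbT.
by apply: measurableU; apply: H.
Qed.

(** The four martingale terms of the expansion average to zero on [A], so only the remainder counts:
    without a jump it is small against the squared increment, whose mean telescopes in [i]; on a
    jump the crude bound applies. *)
Lemma step_bound i A : (i < N)%N -> G i A ->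
  (forall w, A w -> `|x i w| <= M /\ `|y i w| <= M) ->
  `|E (fun w => (f i.+1 w - f i w) * \1_A w)| <=
    K * D * (sq i.+1 - sq i) + K * E (fun w => (1 + W w) * \1_(A `&` jump i) w).
Proof.
move=> iN GA AM; set L := A `&` jump i.
have mA : measurable A by exact: (sG i).2.
have GL : G i.+1 L.
  apply: gmeasurable_set_inv => //; apply: measurableI; apply: gmeasurable_set => //.
  exact: Gmono GA.
have mL : measurable L by exact: (sG i.+1).2.
have [r1 E1] := mean_stopped0 _ _ _ _ _ _ _ (sG i) t1 (mx i) (my i) (cx _ _ (leqnSn i)) GA AM.
have [r2 E2] := mean_stopped0 _ _ _ _ _ _ _ (sG i) t2 (mx i) (my i) (cy _ _ (leqnSn i)) GA AM.
have [r3 E3] := mean_stopped0 _ _ _ _ _ _ _ (sG i) t3 (mx i) (my i) (cu i) GA AM.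
have [r4 E4] := mean_stopped0 _ _ _ _ _ _ _ (sG i) t4 (mx i) (my i) (cv i) GA AM.
have [v1 V1] := mean_increment_sq _ _ _ M _ (sG i) (mx i) (cx _ _ (leqnSn i)) (x2i i) (x2i i.+1) GA
  (fun w Aw => (AM w Aw).1).
have [v2 V2] := mean_increment_sq _ _ _ M _ (sG i) (my i) (cy _ _ (leqnSn i)) (y2i i) (y2i i.+1) GA
  (fun w Aw => (AM w Aw).2).
move: r1 E1 r2 E2 r3 E3 r4 E4.
set H1 := (fun w => h1 _ _ * _ * _); set H2 := (fun w => h2 _ _ * _ * _).
set H3 := (fun w => h3 _ _ * _ * _); set H4 := (fun w => h4 _ _ * _ * _).
move=> r1 E1 r2 E2 r3 E3 r4 E4.
pose H w := H1 w + H2 w + H3 w + H4 w.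
have rH : rintegrable H by rewrite /H; do 3 (apply: rintegrableD => //).
have EH : E H = 0 by rewrite /H !meanD ?E1 ?E2 ?E3 ?E4 ?addr0//; do 2 (try apply: rintegrableD => //).
have fA : rintegrable (fun w => (f i.+1 w - f i w) * \1_A w).
  by apply: rintegrable_indic => //; exact: rintegrableB.
rewrite -[E (fun w => _ * _)]subr0 -EH -meanB//.
pose Q w := K * D * ((x i.+1 w - x i w) ^+ 2 * \1_A w + (y i.+1 w - y i w) ^+ 2 * \1_A w)
  + K * ((1 + (x i.+1 w ^+ p.+2 + y i.+1 w ^+ p.+2)) * \1_L w).
have q1 : rintegrable (fun w => (x i.+1 w - x i w) ^+ 2 * \1_A w + (y i.+1 w - y i w) ^+ 2 * \1_A w).
  exact: rintegrableD.
have q2 : rintegrable (fun w => x i.+1 w ^+ p.+2 + y i.+1 w ^+ p.+2) by exact: rintegrableD.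
have q3 : rintegrable (fun w => 1 + (x i.+1 w ^+ p.+2 + y i.+1 w ^+ p.+2)).
  by apply: rintegrableD => //; exact: rintegrable_cst.
have rQ : rintegrable Q.
  by apply: rintegrableD; apply: rintegrableZ => //; exact: rintegrable_indic.
apply: (@le_trans _ _ (E Q)).
  apply: mean_norm_le => //; first exact: rintegrableB.
  move=> w; rewrite /H /H1 /H2 /H3 /H4 -!mulrDl -mulrBl /Q /L.
  have [wA|wA] := boolP (w \in A); last first.
    by rewrite !indicE in_setI (negbTE wA) /= !(mulr0, addr0, normr0).
  have [xM yM] := AM w (set_mem wA).
  have [sm lg] := expansion _ _ (x i.+1 w) (y i.+1 w) xM yM.
  rewrite !indicE in_setI wA /= !mulr1.
  have [wJ|wJ] := boolP (w \in jump i).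
    rewrite mulr1 addrA -(powE (x i.+1 w)) -(powE (y i.+1 w)); apply: (le_trans lg).
    by rewrite lerDr mulr_ge0 ?mulr_ge0// addr_ge0 ?sqr_ge0.
  rewrite mulr0 mulr0 addr0; apply: sm => //; rewrite leNgt; apply/negP => h;
    move/negP: wJ; apply; apply/mem_set; [by left|by right].
rewrite /Q meanD; [|exact: rintegrableZ|by apply: rintegrableZ; exact: rintegrable_indic].
rewrite !meanZ//; last exact: rintegrable_indic.
rewrite lerD//.
  rewrite ler_wpM2l ?mulr_ge0// meanD// /sq; lra.
rewrite ler_wpM2l//.
have s (a : T -> R) : rintegrable a -> E (fun w => (1 + a w) * \1_L w) =
    E (fun w => 1 * \1_L w) + E (fun w => a w * \1_L w).
  move=> ai; rewrite -meanD; [|apply: rintegrable_indic => //; exact: rintegrable_cst|exact: rintegrable_indic].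
  by congr (mean _ _); apply/funext => w; rewrite mulrDl.
(* The event [L] involves the jump and is known only at time [i.+1], so the crude bound at that time
   is compared with [W]. *)
by rewrite s// [leRHS]s// lerD2l mono_W.
Qed.

(** The event that a stopping time is later than [i]: up to then no step was a jump and the path
    stayed in the box. *)
Fixpoint good i : set T :=
  if i is j.+1 then good j `&` ~` jump j `&`
    ([set w | `|x i w| <= M] `&` [set w | `|y i w| <= M])
  else setT.

(** The paths that stopped before [i] because of a jump. The events added at successive steps are
    disjoint, so their errors sum to a single expectation. *)
Fixpoint stopjump i : set T :=
  if i is j.+1 then stopjump j `|` (good j `&` jump j) else set0.

Let goodM i w : good i w -> `|x i w| <= M /\ `|y i w| <= M.
Proof. by case: i => [|i] /=; [rewrite x0 y0 normr0|move=> [_ []]]. Qed.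

Let goodG i : G i (good i).
Proof.
elim: i => [|i IH] /=.
  by apply: gmeasurable_set_inv.
apply: gmeasurable_set_inv => //; apply: measurableI; first apply: measurableI.
- by apply: gmeasurable_set => //; exact: Gmono IH.
- by apply: measurableC; exact: gmeasurable_set.
- have H (a : T -> R) : gmeasurable (G i.+1) a ->
    (measurable : set (set (g_sigma_algebraType (G i.+1)))) [set w | `|a w| <= M].
    move=> ma.
    have : gmeasurable (G i.+1) (fun w => `|a w|) by apply: measurableT_comp.
    move=> /(_ measurableT [set` `]-oo, M]] (measurable_itv _)).
    by rewrite setTI; congr measurable; apply/seteqP; split => w /=; rewrite in_itv.
  by apply: measurableI; exact: H.
Qed.

Let stopG i : G i (stopjump i).
Proof.
elim: i => [|i IH] /=; first by case: (sG 0) => -[].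
apply: gmeasurable_set_inv => //; apply: measurableU.
  by apply: gmeasurable_set => //; exact: Gmono IH.
apply: measurableI; apply: gmeasurable_set => //.
exact: Gmono (goodG i).
Qed.

Let stop_good i w : stopjump i w -> ~ good i w.
Proof.
elim: i => [//|i IH] /= [/IH h|[_ j]] [[g nj] _]; [exact: h|exact: nj].
Qed.

Let mean_split (a : T -> R) (A B : set T) : rintegrable a -> measurable A -> measurable B ->
  A `&` B = set0 ->
  E (fun w => a w * \1_(A `|` B) w) = E (fun w => a w * \1_A w) + E (fun w => a w * \1_B w).
Proof.
move=> ai mA mB AB; rewrite -meanD; [|exact: rintegrable_indic..].
congr (mean _ _); apply/funext => w; rewrite -mulrDr; congr (_ * _).
rewrite !indicE in_setU; have [wA|_] := boolP (w \in A); last by rewrite add0r.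
have [wB|_] := boolP (w \in B); last by rewrite addr0.
have : (A `&` B) w by split; exact/set_mem.
by rewrite AB.
Qed.

(** Summation of [step_bound] along the surviving paths. The middle term collects the jumps, and the
    last one the values of [f] discarded on paths at the moment they cease to be good. *)
Lemma stopped_bound i : (i <= N)%N ->
  `|E (fun w => f i w * \1_(good i) w)| <= K * D * sq i
    + K * E (fun w => (1 + W w) * \1_(stopjump i) w)
    + 2 ^+ p.+2 * E (fun w => W w * \1_(~` good i) w).
Proof.
have mgood j : measurable (good j) := (sG j).2 _ (goodG j).
have mstop j : measurable (stopjump j) := (sG j).2 _ (stopG j).
have mjump j : measurable (jump j) := (sG j.+1).2 _ (jumpG j).
have W1i : rintegrable (fun w => 1 + W w) by apply: rintegrableD => //; exact: rintegrable_cst.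
elim: i => [_|i IH iN].
  have -> : E (fun w => f 0 w * \1_(good 0) w) = 0.
    rewrite (_ : (fun w => _) = fun=> 0 * 0).
      by rewrite (meanZ _ 0 (fun=> 0)) ?mul0r//; exact: rintegrable_cst.
    apply/funext => w; rewrite /f x0 y0 /zpow.
    by rewrite (_ : 0 +i* 0 = 0 :> R[i])// expr0n/= mul0r mulr0.
  have i0 (A : set T) w : 0 <= (\1_A w : R) by have /andP[] := indic01 A w.
  rewrite normr0; apply: addr_ge0; first apply: addr_ge0.
  - rewrite mulr_ge0 ?(mulr_ge0 K0 D0)//.
    by apply: addr_ge0; apply: mean_ge0 => w; exact: sqr_ge0.
  - by rewrite mulr_ge0//; apply: mean_ge0 => w; rewrite mulr_ge0// addr_ge0.
  - by rewrite mulr_ge0 ?exprn_ge0//; apply: mean_ge0 => w; rewrite mulr_ge0.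
have {}IH := IH (ltnW iN).
have {}step := step_bound i _ iN (goodG i) (goodM i).
(* The paths stopping at this very step. They are the increment of the complement of [good], so the
   last error term also telescopes. *)
pose B := good i `&` ~` good i.+1.
have mB : measurable B by apply: measurableI => //; exact: measurableC.
have GB : G i.+1 B.
  apply: gmeasurable_set_inv => //; apply: measurableI.
    by apply: gmeasurable_set => //; apply: Gmono (goodG i).
  by apply: measurableC; exact: gmeasurable_set.
have goodS w : good i.+1 w -> good i w by move=> [[]].
have -> : E (fun w => f i.+1 w * \1_(good i.+1) w) =
    E (fun w => f i w * \1_(good i) w) + E (fun w => (f i.+1 w - f i w) * \1_(good i) w)
    - E (fun w => f i.+1 w * \1_B w).
  have j1 : rintegrable (fun w => f i w * \1_(good i) w) by exact: rintegrable_indic.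
  have j2 : rintegrable (fun w => (f i.+1 w - f i w) * \1_(good i) w).
    by apply: rintegrable_indic => //; exact: rintegrableB.
  have j3 : rintegrable (fun w => f i.+1 w * \1_B w) by exact: rintegrable_indic.
  rewrite -meanD// -meanB//; last exact: rintegrableD.
  congr (mean _ _); apply/funext => w; rewrite /B !indicE in_setI in_setC.
  have [gS|gS] := boolP (w \in good i.+1).
    by rewrite (mem_set (goodS _ (set_mem gS)))/=; ring.
  by case: (w \in good i) => /=; ring.
have lastle : `|E (fun w => f i.+1 w * \1_B w)| <= 2 ^+ p.+2 * E (fun w => W w * \1_B w).
  apply: (@le_trans _ _ (2 ^+ p.+2 * E (fun w => (x i.+1 w ^+ p.+2 + y i.+1 w ^+ p.+2) * \1_B w))).
    have j : rintegrable (fun w => (x i.+1 w ^+ p.+2 + y i.+1 w ^+ p.+2) * \1_B w).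
      by apply: rintegrable_indic => //; exact: rintegrableD.
    rewrite -meanZ//; apply: mean_norm_le; [exact: rintegrable_indic|exact: rintegrableZ|].
    move=> w; rewrite normrM mulrA [X in _ * X]ger0_norm; last by have /andP[] := indic01 B w.
    by rewrite ler_wpM2r//; have /andP[] := indic01 B w.
  by rewrite ler_wpM2l ?exprn_ge0// mono_W.
have eJ : E (fun w => (1 + W w) * \1_(stopjump i.+1) w) = E (fun w => (1 + W w) * \1_(stopjump i) w)
   + E (fun w => (1 + W w) * \1_(good i `&` jump i) w).
  apply: mean_split => //; first exact: measurableI.
  by apply/seteqP; split => // w [/stop_good h [/h]].
have eC : E (fun w => W w * \1_(~` good i.+1) w) = E (fun w => W w * \1_(~` good i) w)
   + E (fun w => W w * \1_B w).
  rewrite (_ : ~` good i.+1 = ~` good i `|` B).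
    apply: mean_split => //; first exact: measurableC.
    by apply/seteqP; split => // w [h [/h]].
  rewrite /B setUIr [~` good i `|` good i]setUC setUv setTI.
  by apply/seteqP; split => w; [right|move=> [h /goodS|//]].
rewrite eJ eC.
apply: (le_trans (ler_normB _ _)).
have := ler_normD (E (fun w => f i w * \1_(good i) w)) (E (fun w => (f i.+1 w - f i w) * \1_(good i) w)).
move: IH step lastle; rewrite !(mulrDr, mulrN); lra.
Qed.

(** The exceptional paths are covered by [J] (some jump) and [V] (some exit from the box). The
    factor 2 arises because the complement of [good N] is charged twice: in [stopped_bound], and for
    restoring [f N] there. *)
Lemma discrete_bound (J V : set T) : measurable J -> measurable V ->
  (forall i w, (i < N)%N -> jump i w -> J w) ->
  (forall i w, (i <= N)%N -> ~ (`|x i w| <= M /\ `|y i w| <= M) -> V w) ->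
  `|E (f N)| <= K * D * sq N
    + (K + 2 * 2 ^+ p.+2) * E (fun w => (1 + W w) * \1_J w)
    + 2 * 2 ^+ p.+2 * E (fun w => W w * \1_V w).
Proof.
move=> mJ mV hJ hV.
have mgood j : measurable (good j) := (sG j).2 _ (goodG j).
have mstop j : measurable (stopjump j) := (sG j).2 _ (stopG j).
have W1i : rintegrable (fun w => 1 + W w) by apply: rintegrableD => //; exact: rintegrable_cst.
have stopJ i : (i <= N)%N -> stopjump i `<=` J.
  elim: i => [_ w []|i IH iN w /= [sw|[_ jw]]]; [exact: IH (ltnW iN) w sw|exact: hJ iN jw].
have badJV i : (i <= N)%N -> ~` good i `<=` J `|` V.
  elim: i => [_ w /= []//|i IH iN w /= ng].
  have [gi|gi] := pselect (good i w); last exact: IH (ltnW iN) w gi.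
  have [ji|nji] := pselect (jump i w); first by left; exact: hJ ji.
  by right; apply: (hV i.+1) => // h; apply: ng.
have eN : E (f N) = E (fun w => f N w * \1_(good N) w) + E (fun w => f N w * \1_(~` good N) w).
  rewrite -mean_split ?setICr//; last exact: measurableC.
  by rewrite setUv; under [in RHS]eq_fun do rewrite indicT mulr1.
have l2 : `|E (fun w => f N w * \1_(~` good N) w)| <= 2 ^+ p.+2 * E (fun w => W w * \1_(~` good N) w).
  have mC : measurable (~` good N) by exact: measurableC.
  have j : rintegrable (fun w => W w * \1_(~` good N) w) by exact: rintegrable_indic.
  rewrite -meanZ//; apply: mean_norm_le; [exact: rintegrable_indic|exact: rintegrableZ|].
  move=> w; rewrite normrM mulrA [X in _ * X]ger0_norm; last by have /andP[] := indic01 (~` good N) w.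
  by rewrite ler_wpM2r ?fle//; have /andP[] := indic01 (~` good N) w.
have l3 : E (fun w => W w * \1_(~` good N) w) <=
    E (fun w => (1 + W w) * \1_J w) + E (fun w => W w * \1_V w).
  rewrite -meanD; [|exact: rintegrable_indic..].
  apply: mean_le.
  - by apply: rintegrable_indic => //; exact: measurableC.
  - by apply: rintegrableD; exact: rintegrable_indic.
  move=> w; have w0 := W0 w; have /andP[a0 _] := indic01 J w; have /andP[b0 _] := indic01 V w.
  have aW := mulr_ge0 (addr_ge0 ler01 w0) a0; have bW := mulr_ge0 w0 b0.
  rewrite [\1_(~` _) w]indicE; have [/set_mem/(badJV N (leqnn _))[h|h]|_] := boolP (w \in ~` good N).
  - by move: bW; have -> : \1_J w = 1 :> R by [rewrite indicE mem_set]; rewrite !mulr1; lra.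
  - by move: aW; have -> : \1_V w = 1 :> R by [rewrite indicE mem_set]; rewrite !mulr1; lra.
  - by rewrite mulr0 addr_ge0.
have l4 : E (fun w => (1 + W w) * \1_(stopjump N) w) <= E (fun w => (1 + W w) * \1_J w).
  apply: mean_le; [exact: rintegrable_indic..|].
  move=> w; rewrite ler_wpM2l ?addr_ge0// !indicE.
  have [/set_mem/(stopJ N (leqnn _))/mem_set->//|_] := boolP (w \in stopjump N).
  by case: (_ \in J).
have := stopped_bound N (leqnn N); rewrite eN.
have := ler_normD (E (fun w => f N w * \1_(good N) w)) (E (fun w => f N w * \1_(~` good N) w)).
have k2 : 0 <= 2 ^+ p.+2 :> R by exact: exprn_ge0.
have := ler_wpM2l K0 l4; have := ler_wpM2l k2 l3.
move: l2; rewrite !mulrDl !mulrDr.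
lra.
Qed.
End Discrete.

                          

(** * Continuous paths along uniform grids *)

Section Paths.
Context {R : realType}.
Implicit Types (f : R -> R).

Definition grid (t : R) m i : R := t * i%:R / m.+1%:R.

Lemma grid_ge0 t m i : 0 <= t -> 0 <= grid t m i.
Proof. by move=> t0; rewrite divr_ge0// mulr_ge0. Qed.

Lemma grid_le t m i j : 0 <= t -> (i <= j)%N -> grid t m i <= grid t m j.
Proof. by move=> t0 ij; rewrite ler_wpM2r ?invr_ge0// ler_wpM2l// ler_nat. Qed.

Lemma grid_last t m : grid t m m.+1 = t.
Proof. by rewrite /grid mulfK// pnatr_eq0. Qed.

Lemma grid0 t m : grid t m 0 = 0. Proof. by rewrite /grid mulr0 mul0r. Qed.

Lemma gridS t m i : grid t m i.+1 - grid t m i = t / m.+1%:R.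
Proof. by rewrite /grid -mulrBl -mulrBr -natrB// subSnn mulr1. Qed.

Lemma path_cvg f s e : {within `[0, +oo[, continuous f} -> 0 <= s -> 0 < e ->
  exists2 r, 0 < r & forall u, 0 <= u -> `|u - s| < r -> `|f u - f s| < e.
Proof.
move=> /subspace_continuousP cf s0 e0.
have /cf /cvgrPdist_lt/(_ _ e0) : `[0, +oo[%classic s by rewrite /= in_itv/= s0.
rewrite /within/= => -[r /= r0 rP]; exists r => // u u0 us.
by rewrite distrC; apply: rP; rewrite /ball/= ?in_itv/= ?u0// distrC.
Qed.

Lemma path_bounded f t : {within `[0, +oo[, continuous f} ->
  exists m : nat, forall j, (m <= j)%N -> forall s, 0 <= s <= t -> `|f s| <= j%:R.
Proof.
move=> cf.
have /compact_near_coveringP cov := @segment_compact R 0 t.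
have [m _ mP] : \forall j \near \oo, `[0, t] `<=` [set s | 0 <= s -> `|f s| <= j%:R]; last first.
  exists m => j mj s /[dup] st /andP[s0 _]; apply: (mP j mj) s0.
  by rewrite /= in_itv.
apply: cov => s; rewrite /= in_itv/= => /andP[s0 _].
have [r r0 rP] := path_cvg _ _ _ cf s0 ltr01.
exists (ball s r, [set j : nat | `|f s| + 1 <= j%:R]) => /=.
  split; first exact: nbhsx_ballx.
  exists (Num.trunc (`|f s| + 1)).+1 => // j /= mj.
  by rewrite ltW// (lt_le_trans (truncnS_gt _))// ler_nat.
move=> [u j] /= [su sj] u0.
rewrite (le_trans _ sj)// -lerBlDl (le_trans (lerB_dist _ _))// ltW// rP//.
by rewrite distrC.
Qed.

(** Uniform continuity on the compact interval, as a near-covering argument: around each [s] a ball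
    of radius [r / 2] and a mesh below [r / 2] keep both ends of a step within [r] of [s]. *)
Lemma path_uniform f t e : {within `[0, +oo[, continuous f} -> 0 <= t -> 0 < e ->
  exists m0, forall m, (m0 <= m)%N -> forall i, (i < m.+1)%N ->
    `|f (grid t m i.+1) - f (grid t m i)| <= e.
Proof.
move=> cf t0 e0.
have /compact_near_coveringP cov := @segment_compact R 0 t.
have [m _ mP] : \forall m \near \oo, `[0, t] `<=` [set s | 0 <= s -> forall u, 0 <= u ->
    `|u - s| <= t / m.+1%:R -> `|f u - f s| <= e]; last first.
  exists m => j mj i ij; apply: (mP j mj); rewrite ?grid_ge0//.
    by rewrite /= in_itv/= grid_ge0//= -[leRHS](grid_last t j) grid_le// ltnW.
  by rewrite gridS ger0_norm// divr_ge0.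
apply: cov => s; rewrite /= in_itv/= => /andP[s0 _].
have e20 : 0 < e / 2 by rewrite divr_gt0.
have [r r0 rP] := path_cvg _ _ _ cf s0 e20.
exists (ball s (r / 2), [set m : nat | t / m.+1%:R < r / 2]) => /=.
  split; first by apply: nbhsx_ballx; rewrite divr_gt0.
  exists (Num.trunc (t / (r / 2))).+1 => // j /= mj.
  rewrite ltr_pdivrMr// mulrC -ltr_pdivrMr ?divr_gt0//.
  by rewrite (lt_le_trans (truncnS_gt _))// ler_nat (leq_trans mj).
move=> [u m] /= [su mr] u0 v v0 uv.
have su' : `|u - s| < r / 2 by rewrite distrC.
have vs : `|v - s| < r.
  have {}mr : t / m.+1%:R < r / 2 := mr.
  by rewrite (le_lt_trans (ler_distD u v s))// [ltRHS]splitr ltrD// (le_lt_trans uv).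
have us : `|u - s| < r.
  by rewrite (lt_le_trans su')// ler_pdivrMr// ler_peMr ?ltW// ltr1n.
rewrite ltW// (le_lt_trans (ler_distD (f s) _ _))// [ltRHS]splitr ltrD ?rP//.
by rewrite distrC rP.
Qed.
End Paths.

(** * The real part of the power of a conformal martingale has mean zero *)

Section Continuous.
Context {d : measure_display} {T : measurableType d} {R : realType}.
Variable P : probability T R.
Local Notation rintegrable := (rintegrable P).
Local Notation E := (mean P).
Local Notation cond_mean0 := (cond_mean0 P).

Lemma cond_mean0B (G : set (set T)) (f g : T -> R) : sub_algebra G -> cond_mean0 G f -> cond_mean0 G g ->
  cond_mean0 G (fun w => f w - g w).
Proof.
move=> sG [fi f0] [gi g0]; split; first exact: rintegrableB.
move=> A GA; have mA := sG.2 _ GA.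
under eq_fun do rewrite mulrBl.
by rewrite meanB ?f0 ?g0 ?subr0//; exact: rintegrable_indic.
Qed.

Lemma martingale_cond0 (F : R -> set (set T)) (Z : R -> T -> R) s t :
  sub_algebra (F s) -> martingale P F Z -> 0 <= s -> s <= t ->
  cond_mean0 (F s) (fun w => Z t w - Z s w).
Proof.
move=> sF [_ [Zi Zm]] s0 st.
have it : rintegrable (Z t) by apply: Zi; exact: le_trans st.
have is_ : rintegrable (Z s) by exact: Zi.
split; first exact: rintegrableB.
move=> A FA; have mA := sF.2 _ FA.
under eq_fun do rewrite mulrBl.
rewrite meanB ?mean_indic; [|exact: rintegrable_indic..].
by rewrite /Rintegral (Zm s t s0 st A FA) subrr.
Qed.

Variables (F : R -> set (set T)) (X Y : R -> T -> R) (p : nat).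
Hypothesis uF : usual_filtration P F.
Hypotheses (mX : martingale P F X) (mY : martingale P F Y).
Hypotheses (cX : cont_paths X) (cY : cont_paths Y).
Hypotheses (X0 : forall w, X 0 w = 0) (Y0 : forall w, Y 0 w = 0).
Hypothesis conf : conformal P F X Y.
Hypothesis ep : ~~ odd p.
Hypothesis iX : forall s, 0 <= s -> rintegrable (fun w => X s w ^+ p.+2).
Hypothesis iY : forall s, 0 <= s -> rintegrable (fun w => Y s w ^+ p.+2).

Lemma filtration_sub s : 0 <= s -> sub_algebra (F s).
Proof. by case: uF => sF [mF _] s0; split; [exact: sF|exact: mF]. Qed.

Lemma mean_zpow0 t : 0 <= t -> E (fun w => zpow p.+2 (X t w) (Y t w)) = 0.
Proof.
move=> t0.
have sub s : 0 <= s -> sub_algebra (F s) by exact: filtration_sub.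
have mono s u : 0 <= s -> s <= u -> F s `<=` F u by case: uF => _ [_ [+ _]]; exact.
have [A [[[_ [_ [_ [_ mXX]]]] _] [[[_ [_ [_ [_ mYY]]]] _] [_ [_ [_ [_ mXY]]]]]]] := conf.
(* The common bracket [A] cancels in the difference of the martingales [X^2 - A] and [Y^2 - A]. *)
have cu s u : 0 <= s -> s <= u -> cond_mean0 (F s)
    (fun w => (X u w ^+ 2 - Y u w ^+ 2) - (X s w ^+ 2 - Y s w ^+ 2)).
  move=> s0 su; have := cond_mean0B _ _ _ (sub s s0) (martingale_cond0 _ _ _ _ (sub s s0) mXX s0 su)
    (martingale_cond0 _ _ _ _ (sub s s0) mYY s0 su).
  by congr (cond_mean0 _ _); apply/funext => w; ring.
have cv s u : 0 <= s -> s <= u -> cond_mean0 (F s) (fun w => X u w * Y u w - X s w * Y s w).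
  move=> s0 su; have := martingale_cond0 _ _ _ _ (sub s s0) mXY s0 su.
  by congr (cond_mean0 _ _); apply/funext => w; rewrite !subr0.
have GX s : 0 <= s -> gmeasurable (F s) (X s).
  by move=> s0; apply/(gmeasurableP _ _ (sub s s0)); exact: mX.1.
have GY s : 0 <= s -> gmeasurable (F s) (Y s).
  by move=> s0; apply/(gmeasurableP _ _ (sub s s0)); exact: mY.1.
have meas s : 0 <= s -> measurable_fun setT (X s) /\ measurable_fun setT (Y s).
  by move=> s0; split; [exact: gmeasurable_meas (sub s s0) (GX s s0)|exact: gmeasurable_meas (sub s s0) (GY s s0)].
pose W w := X t w ^+ p.+2 + Y t w ^+ p.+2.
have iW : rintegrable W by apply: rintegrableD; [exact: iX|exact: iY].
have W0 w : 0 <= W w by rewrite addr_ge0// exprn_even_ge0//= negbK.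
have iW1 : rintegrable (fun w => 1 + W w) by apply: rintegrableD => //; exact: rintegrable_cst.
(* Exits from the box at points of any grid: a countable union, hence measurable, and independent of
   the mesh, so that [j] can be fixed before the mesh. *)
pose V j := \bigcup_m \bigcup_(i in [set i | (i <= m.+1)%N])
  [set w | ~ (`|X (grid t m i) w| <= j%:R /\ `|Y (grid t m i) w| <= j%:R)].
have norm_le (Z : T -> R) (a : R) : measurable_fun setT Z -> measurable [set w | `|Z w| <= a].
  move=> mZ; have : measurable_fun setT (fun w => `|Z w|) by exact: measurableT_comp.
  move=> /(_ measurableT [set` `]-oo, a]] (measurable_itv _)).
  by rewrite setTI; congr measurable; apply/seteqP; split => w /=; rewrite in_itv.
have norm_gt (Z : T -> R) (a : R) : measurable_fun setT Z -> measurable [set w | a < `|Z w|].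
  move=> mZ; have := measurableC (norm_le Z a mZ).
  by congr measurable; apply/seteqP; split => w /=; rewrite ltNge => /negP.
have mV j : measurable (V j).
  apply: bigcup_measurable => m _; apply: bigcup_measurable => i _.
  have [mXi mYi] := meas _ (grid_ge0 t m i t0).
  apply: (measurableC (measurableI _ _ (norm_le _ j%:R mXi) (norm_le _ j%:R mYi))).
have Vv w : exists m0, forall j, (m0 <= j)%N -> ~ V j w.
  have [m1 m1P] := path_bounded _ t (cX w); have [m2 m2P] := path_bounded _ t (cY w).
  exists (maxn m1 m2) => j; rewrite geq_max => /andP[j1 j2] [m _ [i /= im]]; apply.
  have gt : 0 <= grid t m i <= t by rewrite grid_ge0//= -[leRHS](grid_last t m) grid_le.
  by split; [exact: m1P|exact: m2P].
apply/eqP; rewrite -normr_eq0; apply/eqP/le_anti; rewrite normr_ge0 andbT.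
apply/ler_addgt0Pr => e e0; rewrite add0r.
have e3 : 0 < e / 3 by rewrite divr_gt0.
have c0 : 0 < 2 * 2 ^+ p.+2 :> R by rewrite mulr_gt0// exprn_gt0.
(* Order of the choices: the box size [j], then the constant [K] of the expansion on that box, then
   the step bound [D], and finally the mesh [m]. Each of the three error terms of [discrete_bound]
   gets a third of [e]. *)
have [j jP] := mean_vanishing _ _ _ iW W0 mV Vv (e / 3 / (2 * 2 ^+ p.+2)) (divr_gt0 e3 c0).
have [h1 [h2 [h3 [h4 [t1 t2 t3 t4 /(_ j%:R)[K K0 exps]]]]]] := @zpow_expansion R p.
set q := E (fun w => X t w ^+ 2) + E (fun w => Y t w ^+ 2).
have q0 : 0 <= q by rewrite addr_ge0//; apply: mean_ge0 => w; rewrite sqr_ge0.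
(* The [1] in the denominator keeps it positive when [K * q] vanishes; the minimum with 1 is
   demanded by the expansion. *)
pose D : R := Num.min 1 (e / 3 / (K * q + 1)).
have Kq : 0 <= K * q by rewrite mulr_ge0.
have D0 : 0 < D by rewrite lt_min ltr01 !divr_gt0//; lra.
have D1 : D <= 1 by rewrite ge_min lexx.
have KDq : K * D * q <= e / 3.
  have : D <= e / 3 / (K * q + 1) by rewrite ge_min lexx orbT.
  rewrite ler_pdivlMr; last by lra.
  by apply: le_trans; rewrite mulrAC mulrC ler_wpM2l// ?ltW// ltrDl.
pose J m := \bigcup_(i in [set i | (i < m.+1)%N])
  jump (fun i => X (grid t m i)) (fun i => Y (grid t m i)) D i.
have mJ m : measurable (J m).
  apply: bigcup_measurable => i _.
  have [mXi mYi] := meas _ (grid_ge0 t m i t0).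
  have [mXj mYj] := meas _ (grid_ge0 t m i.+1 t0).
  by apply: measurableU; apply: norm_gt; exact: measurable_funB.
have Jv w : exists m0, forall m, (m0 <= m)%N -> ~ J m w.
  have [m1 m1P] := path_uniform _ t D (cX w) t0 D0.
  have [m2 m2P] := path_uniform _ t D (cY w) t0 D0.
  exists (maxn m1 m2) => m; rewrite geq_max => /andP[j1 j2] [i /= im] [] /=;
    rewrite ltNge; move/negP; apply; [exact: m1P|exact: m2P].
have W10 w : 0 <= 1 + W w by rewrite addr_ge0.
have cK : 0 < K + 2 * 2 ^+ p.+2 by lra.
have [m mP] := mean_vanishing _ _ _ iW1 W10 mJ Jv (e / 3 / (K + 2 * 2 ^+ p.+2)) (divr_gt0 e3 cK).
have g0 i := grid_ge0 t m i t0.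
have gl i k (ik : (i <= k)%N) := grid_le t m i k t0 ik.
have := @discrete_bound _ _ _ P (fun i => F (grid t m i)) (fun i => X (grid t m i))
  (fun i => Y (grid t m i)) p (fun i => sub _ (g0 i)) (fun i k ik => mono _ _ (g0 i) (gl i k ik))
  (fun i => GX _ (g0 i)) (fun i => GY _ (g0 i))
  (fun i k ik => martingale_cond0 _ _ _ _ (sub _ (g0 i)) mX (g0 i) (gl i k ik))
  (fun i k ik => martingale_cond0 _ _ _ _ (sub _ (g0 i)) mY (g0 i) (gl i k ik))
  (fun i => cu _ _ (g0 i) (gl i i.+1 (leqnSn i)))
  (fun i => cv _ _ (g0 i) (gl i i.+1 (leqnSn i))) ep
  (fun i => iX _ (g0 i)) (fun i => iY _ (g0 i))
  (fun w => etrans (congr1 (X ^~ w) (grid0 t m)) (X0 w))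
  (fun w => etrans (congr1 (Y ^~ w) (grid0 t m)) (Y0 w))
  m.+1 j%:R D K h1 h2 h3 h4 t1 t2 t3 t4 (ler0n _ j) (ltW D0) D1 K0 exps (J m) (V j) (mJ m) (mV j).
rewrite grid_last => bound.
apply: (le_trans (bound _ _)).
- by move=> i w im h; exists i.
- by move=> i w im h; exists m => //; exists i.
move: jP mP; rewrite !ltr_pdivlMr//.
rewrite -/W -/q; lra.
Qed.
End Continuous.

                  

(** * From moments to norms, and the conclusion *)

Section Lnorm.
Context {d : measure_display} {T : measurableType d} {R : realType}.
Variable P : probability T R.
Variable k : nat.

Lemma normX_even (a : R) : (0 < k)%N -> `|a| ^+ (2 ^ k) = a ^+ (2 ^ k).
Proof. by move=> k0; rewrite -normrX ger0_norm// exprn_even_ge0// oddX/= orbF -lt0n k0. Qed.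

Lemma poweR_normE (a : R) : (0 < k)%N -> (`|a%:E| `^ (2 ^+ k) = (a ^+ (2 ^ k))%:E)%E.
Proof. by move=> k0; rewrite -natrX poweR_EFin powR_mulrn// normX_even. Qed.

Lemma LnormE (f : T -> R) : (0 < k)%N -> rintegrable P (fun w => f w ^+ (2 ^ k)) ->
  Lnorm P (2 ^+ k)%:E (fun w => (f w)%:E) =
    (mean P (fun w => f w ^+ (2 ^ k)) `^ (2 ^+ k)^-1)%:E.
Proof.
move=> k0 fi; rewrite unlock; under eq_integral do rewrite poweR_normE//.
rewrite -poweR_EFin /mean /Rintegral fineK//.
exact: (integrable_fin_num measurableT fi).
Qed.

Lemma rintegrable_Lnorm (f : T -> R) : (0 < k)%N -> measurable_fun setT f ->
  (Lnorm P (2 ^+ k)%:E (fun w => (f w)%:E) < +oo)%E -> rintegrable P (fun w => f w ^+ (2 ^ k)).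
Proof.
move=> k0 mf fi; apply/integrableP; split.
  by apply/measurable_EFinP; exact: measurable_funX.
have e2 : 2 ^+ k != 0 :> R by rewrite expf_neq0.
have /poweR_lty := fi; move=> /(_ (2 ^+ k)).
rewrite (poweR_Lnorm _ _ e2) => h; apply: le_lt_trans h.
rewrite le_eqVlt; apply/orP; left; apply/eqP; apply: eq_integral => w _.
by rewrite poweR_normE//= normrX normX_even.
Qed.
End Lnorm.

Theorem theorem4p9 (d : measure_display) (T : measurableType d) (R : realType)
  (P : probability T R) (F : R -> set (set T)) (X Y : R -> T -> R) (k : nat) :
  (0 < k)%N ->
  usual_filtration P F ->
  martingale P F X -> martingale P F Y ->
  cont_paths X -> cont_paths Y ->
  (forall w, X 0 w = 0) -> (forall w, Y 0 w = 0) ->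
  Lp_bounded P (2 ^+ k) X -> Lp_bounded P (2 ^+ k) Y ->
  conformal P F X Y ->
  (mnorm P (2 ^+ k) Y <= (cot (pi / (2 * 2 ^+ k)))%:E * mnorm P (2 ^+ k) X)%E.
Proof.
move=> k0 uF mX mY cX cY X0 Y0 lX lY conf.
have pi0 := pi_gt0 R.
have n0 : (0 < 2 ^ k)%N by rewrite expn_gt0.
have pw1 : 1 < 2 ^+ k :> R by rewrite exprn_egt1 ?ltr1n// -lt0n.
have int_pow Z : martingale P F Z -> (forall w, Z 0 w = 0) -> Lp_bounded P (2 ^+ k) Z ->
    forall s, 0 <= s -> rintegrable P (fun w => Z s w ^+ (2 ^ k)).
  (* The supremum in [mnorm] runs over positive times only, so time zero is settled by the initial
     value. *)
  move=> mZ Z0 lZ s; rewrite le_eqVlt => /predU1P[<-|s0].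
    rewrite (_ : (fun w => _) = fun=> 0); first exact: rintegrable_cst.
    by apply/funext => w; rewrite Z0 expr0n gtn_eqF.
  apply: rintegrable_Lnorm => //; first by apply: rintegrable_meas; apply: mZ.2.1; exact: ltW.
  apply: le_lt_trans lZ; apply: ereal_sup_ubound.
  by exists s => //=; rewrite in_itv/= s0.
have iX := int_pow X mX X0 lX; have iY := int_pow Y mY Y0 lY.
have c0 : 0 < cot (pi / (2 * 2 ^+ k)) :> R.
  apply: cot_gt0; first by rewrite divr_gt0// mulr_gt0// exprn_gt0.
  by rewrite ltr_pM2l// ltf_pV2 ?posrE ?mulr_gt0 ?exprn_gt0// ltr_pMr.
set c := cot _ in c0 *.
apply: ge_ereal_sup => _ [t + <-]; rewrite /= in_itv/= andbT => t0.
have Ez : mean P (fun w => zpow (2 ^ k) (X t w) (Y t w)) = 0.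
  have [p pE] : exists p, (2 ^ k)%N = p.+2.
    by exists (2 ^ k).-2; case: (2 ^ k)%N (ltn_expl k (ltnSn 1)) k0 => [|[|?]] //; case: (k).
  have ep : ~~ odd p by have := oddX 2 k; rewrite pE/= orbF negbK eqn0Ngt k0 => ->.
  rewrite pE; apply: (mean_zpow0 _ _ _ _ _ uF mX mY cX cY X0 Y0 conf ep _ _ _ (ltW t0)).
  - by move=> s s0; have := iX s s0; rewrite pE.
  - by move=> s s0; have := iY s s0; rewrite pE.
have t0' := ltW t0.
have EYX : mean P (fun w => Y t w ^+ (2 ^ k)) <= c ^+ (2 ^ k) * mean P (fun w => X t w ^+ (2 ^ k)).
  (* The term with [b] integrates to zero by [Ez], whatever the sign of [b]. *)
  have [b [g bP]] := @pointwise_ineq R k.-1; move: bP; rewrite prednK// => bP.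
  have zi : rintegrable P (fun w => zpow (2 ^ k) (X t w) (Y t w)).
    by apply: rintegrable_zpow; [exact/rintegrable_meas/mX.2.1|exact/rintegrable_meas/mY.2.1|exact: iX|exact: iY].
  have -> : c ^+ (2 ^ k) * mean P (fun w => X t w ^+ (2 ^ k)) =
      mean P (fun w => c ^+ (2 ^ k) * X t w ^+ (2 ^ k) + b * zpow (2 ^ k) (X t w) (Y t w)).
    rewrite meanD; [|by apply: rintegrableZ; exact: iX|exact: rintegrableZ].
    by rewrite !meanZ ?Ez ?mulr0 ?addr0//; exact: iX.
  apply: mean_le; [exact: iY| |by move=> w; have [] := bP (X t w) (Y t w)].
  by apply: rintegrableD; apply: rintegrableZ => //; exact: iX.
apply: (@le_trans _ _ (c%:E * Lnorm P (2 ^+ k)%:E (fun w => (X t w)%:E))%E); last first.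
  rewrite lee_pmul2l//; apply: ereal_sup_ubound.
  by exists t => //=; rewrite in_itv/= t0.
rewrite !LnormE//; [|exact: iY|exact: iX].
have E0 (Z : R -> T -> R) : 0 <= mean P (fun w => Z t w ^+ (2 ^ k)).
  by apply: mean_ge0 => w; rewrite -normX_even// exprn_ge0.
rewrite -EFinM lee_fin.
have cn0 : 0 <= c ^+ (2 ^ k) by rewrite exprn_ge0// ltW.
(* The root of the moment inequality turns the constant back into the cotangent. *)
have cE : (c ^+ (2 ^ k)) `^ (2 ^+ k)^-1 = c.
  rewrite -natrX -(powR_mulrn (2 ^ k) (ltW c0)) -powRrM divff ?pnatr_eq0 -?lt0n//.
  by rewrite powRr1// ltW.
rewrite -[X in X * _]cE -(powRM _ cn0 (E0 X)).
apply: ge0_ler_powR; rewrite ?nnegrE ?E0// ?mulr_ge0 ?E0//.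
Qed.
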